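(* Let $b>0$, let $l\ge1$ be an integer and let $q\in C^{2l+1}[0,b]$. With $u$, $u_N$, $\varepsilon_N$ and $c_l$ as defined in the context, for every $x\in(0,b]$ and every $N\in\{0,1,2,\dots\}$ the estimate $$|u(\omega,x)-u_N(\omega,x)|\le c_l\,\varepsilon_N(x)$$ holds for any $\omega\in\mathbb{R}$.
   Context: Consider the perturbed Bessel equation $-u''+\left(\frac{l(l+1)}{x^2}+q(x)\right)u=\omega^2u$ on $(0,b]$. $J_\nu$ is the Bessel function of the first kind; powers and $J_\nu$ are taken with principal branches, with $\sqrt{\omega x}=\sqrt\omega\sqrt x$. Let $u(\omega,x)$ be its regular solution satisfying $u(\omega,x)\sim\frac{(\omega x)^{l+1}}{2^{l+1/2}\Gamma(l+3/2)}$ as $x\to0$ (and $u(0,\cdot)\equiv0$). Kernels. Let $\tilde y(\omega,x)=\Gamma\left(l+\frac32\right)2^{l+\frac12}\omega^{-l-\frac12}\sqrt{x}\,J_{l+\frac12}(\omega x)$ (equal to $x^{l+1}$ for $\omega=0$) be the regular solution of the unperturbed equation ($q\equiv0$) with $\tilde y\sim x^{l+1}$ as $x\to0$. It is known that there is a continuous kernel $K(x,t)$, $0\le t\le x\le b$, independent of $\omega$, with $K(x,x)=\frac12\int_0^xq(s)\,ds$, such that for every $\omega\in\mathbb{C}$ the function $\tilde u(\omega,x)=\tilde y(\omega,x)+\int_0^xK(x,t)\,\tilde y(\omega,t)\,dt$ is the regular solution of the perturbed Bessel equation with $\tilde u(\omega,x)\sim x^{l+1}$ as $x\to0$. The kernel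 $R$ is the $\omega$-independent function for which $\tilde u(\omega,x)=\tilde y(\omega,x)+\int_0^xR(x,t)\cos(\omega t)\,dt$ for all $\omega\in\mathbb{C}$; it is known that it is given by $R(x,s)=\frac{2\Gamma\left(l+\frac32\right)}{\sqrt{\pi}\,\Gamma(l+1)}\int_s^xK(x,t)\,t^{-l}(t^2-s^2)^l\,dt$. The functions $\beta_k$ are defined by the Fourier--Legendre expansion $R(x,t)=\sum_{k=0}^\infty\frac{\beta_k(x)}{x}P_{2k}\left(\frac tx\right)$, with $P_{2k}$ the Legendre polynomials, i.e. $\beta_k(x)=(4k+1)\int_0^xR(x,t)P_{2k}\left(\frac tx\right)dt$. Approximations. With $P_m^{(\alpha,\beta)}$ the Jacobi polynomials, put $$K_N(x,t)=\frac{\sqrt{\pi}\,t^{l+1}}{x^{2l+3}\Gamma\left(l+\frac32\right)}\sum_{m=0}^{N}\frac{(-1)^{m+l+1}\Gamma\left(m+2l+\frac52\right)}{\Gamma\left(m+l+\frac32\right)}\beta_{m+l+1}(x)P_m^{\left(l+\frac12,l+1\right)}\left(1-2\frac{t^2}{x^2}\right),$$ $$u_N(\omega,x)=\sqrt{\omega x}\,J_{l+1/2}(\omega x)+\frac{\sqrt{\pi\omega}}{x^{2l+3}\Gamma(l+3/2)}\sum_{m=0}^N\frac{(-1)^{m+l+1}\Gamma(m+2l+5/2)}{\Gamma(m+l+3/2)}\beta_{m+l+1}(x)\,\mathcal{I}_{l,m}(\omega,x),$$ where $\mathcal{I}_{l,m}(\omega,x)=\int_0^xt^{l+3/2}J_{l+1/2}(\omega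 t)P_m^{(l+1/2,l+1)}\left(1-2\frac{t^2}{x^2}\right)dt$. Put $\varepsilon_N(x)=\|K(x,\cdot)-K_N(x,\cdot)\|_{L_1[0,x]}$, and let $c_l$ be a constant such that $|\sqrt z\,J_{l+1/2}(z)|\le c_l$ for all $z\in\mathbb{R}$. *)

(* Defs.v *)
From Stdlib Require Export Reals Factorial.
From Coquelicot Require Export Coquelicot.
Open Scope R_scope.

(** * Calculus for functions [R -> C]

    [C] is used as a real Banach space; its norm there is [Cmod]. *)

Definition CInt (f : R -> C) (a b : R) : C :=
  RInt (V := C_R_CompleteNormedModule) f a b.

Definition CSeries (a : nat -> C) : C :=
  (Series (fun k => Re (a k)), Series (fun k => Im (a k))).

(** Derivative along [D]; this is [is_derive] with [locally x] replaced by
    [within D (locally x)], hence one-sided at an endpoint of an interval. *)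
Definition is_derive_on (D : R -> Prop) (f : R -> C) (x : R) (d : C) : Prop :=
  filterdiff (U := R_NormedModule) (V := C_R_NormedModule)
    f (within D (locally x)) (fun h : R => scal h d).

Definition Ck_on (n : nat) (D : R -> Prop) (f : R -> C) : Prop :=
  exists d : nat -> R -> C,
    (forall x, D x -> d 0%nat x = f x) /\
    (forall k x, (k < n)%nat -> D x -> is_derive_on D (d k) x (d (S k) x)) /\
    (forall k, (k <= n)%nat ->
       continuous_on (T := R_UniformSpace) (U := C_UniformSpace) D (d k)).

(** [f ~ g] as [x -> 0+]. *)
Definition equiv_at_0 (f g : R -> C) : Prop :=
  filterlim (fun x => (f x / g x)%C) (at_right 0) (locally (RtoC 1)).

(** * Special functions *)

(** Principal argument, in [(-PI, PI]]; only used at [z <> 0]. *)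
Definition Carg (z : C) : R :=
  if Rle_dec 0 (Im z) then acos (Re z / Cmod z) else - acos (Re z / Cmod z).

(** Principal branch of [z ^ a] for real [a]. The value [0] at [z = 0] is the
    right one for [a > 0]; no other exponent is used there. *)
Definition Cpower (z : C) (a : R) : C :=
  if Ceq_dec z 0 then RtoC 0
  else (RtoC (Rpower (Cmod z) a) * (cos (a * Carg z), sin (a * Carg z)))%C.

Definition Csqrt (z : C) : C := Cpower z (1 / 2).

Definition Ccos (z : C) : C :=
  (cos (Re z) * cosh (Im z), - (sin (Re z) * sinh (Im z))).

(** For [s > 0]. *)
Definition Gamma (s : R) : R :=
  RInt_gen (fun t => Rpower t (s - 1) * exp (- t))
    (at_right 0) (Rbar_locally p_infty).

(** For [nu > -1]. *)
Definition BesselJ (nu : R) (z : C) : C :=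
  (Cpower (z / RtoC 2) nu *
   CSeries (fun k =>
     RtoC ((-1) ^ k / (INR (fact k) * Gamma (INR k + nu + 1))) *
     (z / RtoC 2) ^ (2 * k)))%C.

(** Generalized binomial coefficient [a (a-1) ... (a-k+1) / k!]. *)
Fixpoint gbinom (a : R) (k : nat) : R :=
  match k with
  | O => 1
  | S j => gbinom a j * (a - INR j) / INR (S j)
  end.

Definition JacobiP (m : nat) (a b x : R) : R :=
  sum_n (fun s => gbinom (INR m + a) (m - s) * gbinom (INR m + b) s *
                  ((x - 1) / 2) ^ s * ((x + 1) / 2) ^ (m - s)) m.

Definition LegendreP (n : nat) (x : R) : R := JacobiP n 0 0 x.

(** * The perturbed Bessel equation and its regular solutions *)

Definition half_open (b x : R) : Prop := 0 < x <= b.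

(** [- y'' + (l (l + 1) / x^2 + q) y = w^2 y] on [(0, b]]. *)
Definition solves_Bessel (l : nat) (q : R -> C) (b : R) (w : C) (y : R -> C)
  : Prop :=
  exists dy ddy : R -> C, forall x, half_open b x ->
    is_derive_on (half_open b) y x (dy x) /\
    is_derive_on (half_open b) dy x (ddy x) /\
    (- ddy x + (RtoC (INR l * (INR l + 1) / x ^ 2) + q x) * y x
     = w ^ 2 * y x)%C.

Definition regular_solution (l : nat) (q : R -> C) (b : R) (u : C -> R -> C)
  : Prop :=
  (forall w, w <> RtoC 0 ->
     solves_Bessel l q b w (u w) /\
     equiv_at_0 (u w)
       (fun x => ((w * RtoC x) ^ (l + 1) /
                  RtoC (Rpower 2 (INR l + 1 / 2) * Gamma (INR l + 3 / 2)))%C))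
  /\ (forall x, half_open b x -> u (RtoC 0) x = RtoC 0).

(** * Integral kernels *)

Definition ytilde (l : nat) (w : C) (x : R) : C :=
  if Ceq_dec w 0 then RtoC (x ^ (l + 1))
  else (RtoC (Gamma (INR l + 3 / 2) * Rpower 2 (INR l + 1 / 2)) *
        Cpower w (- INR l - 1 / 2) * RtoC (sqrt x) *
        BesselJ (INR l + 1 / 2) (w * RtoC x))%C.

Definition utilde (l : nat) (K : R -> R -> C) (w : C) (x : R) : C :=
  (ytilde l w x + CInt (fun t => K x t * ytilde l w t) 0 x)%C.

Definition is_kernel_K (l : nat) (q : R -> C) (b : R) (K : R -> R -> C)
  : Prop :=
  continuous_on (T := prod_UniformSpace R_UniformSpace R_UniformSpace)
    (U := C_UniformSpace)
    (fun p => 0 <= snd p <= fst p /\ fst p <= b)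
    (fun p => K (fst p) (snd p)) /\
  (forall x, 0 <= x <= b -> K x x = (RtoC (1 / 2) * CInt q 0 x)%C) /\
  (forall w, solves_Bessel l q b w (utilde l K w) /\
             equiv_at_0 (utilde l K w) (fun x => RtoC (x ^ (l + 1)))).

(** The representation for all complex [w] determines [R x] almost everywhere
    on [[0, x]], hence determines [beta] below. *)
Definition is_kernel_R (l : nat) (b : R) (K Rk : R -> R -> C) : Prop :=
  forall x, half_open b x ->
    ex_RInt (V := C_R_NormedModule) (Rk x) 0 x /\
    forall w, utilde l K w x =
      (ytilde l w x + CInt (fun t => Rk x t * Ccos (w * RtoC t)) 0 x)%C.

(** Fourier-Legendre coefficients:
    [R x t = sum_k beta k x / x * LegendreP (2 k) (t / x)]. *)
Definition beta (Rk : R -> R -> C) (k : nat) (x : R) : C :=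
  (RtoC (4 * INR k + 1) *
   CInt (fun t => Rk x t * RtoC (LegendreP (2 * k) (t / x))) 0 x)%C.

(** * The approximations *)

Definition coefN (l : nat) (Rk : R -> R -> C) (m : nat) (x : R) : C :=
  (RtoC ((-1) ^ (m + l + 1) * Gamma (INR m + 2 * INR l + 5 / 2) /
         Gamma (INR m + INR l + 3 / 2)) *
   beta Rk (m + l + 1) x)%C.

Definition K_N (l : nat) (Rk : R -> R -> C) (N : nat) (x t : R) : C :=
  (RtoC (sqrt PI * t ^ (l + 1) / (x ^ (2 * l + 3) * Gamma (INR l + 3 / 2))) *
   sum_n (fun m =>
     coefN l Rk m x *
     RtoC (JacobiP m (INR l + 1 / 2) (INR l + 1) (1 - 2 * t ^ 2 / x ^ 2))) N)%C.

Definition I_lm (l m : nat) (w : C) (x : R) : C :=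
  CInt (fun t =>
    (Cpower (RtoC t) (INR l + 3 / 2) *
     BesselJ (INR l + 1 / 2) (w * RtoC t) *
     RtoC (JacobiP m (INR l + 1 / 2) (INR l + 1) (1 - 2 * t ^ 2 / x ^ 2)))%C)
    0 x.

Definition u_N (l : nat) (Rk : R -> R -> C) (N : nat) (w : C) (x : R) : C :=
  (Csqrt (w * RtoC x) * BesselJ (INR l + 1 / 2) (w * RtoC x) +
   Csqrt (RtoC PI * w) / RtoC (x ^ (2 * l + 3) * Gamma (INR l + 3 / 2)) *
   sum_n (fun m => coefN l Rk m x * I_lm l m w x) N)%C.

(** The [L_1] norm of [K x - K_N x] on [[0, x]]; both functions are continuous
    there. *)
Definition epsN (l : nat) (K Rk : R -> R -> C) (N : nat) (x : R) : R :=
  RInt (fun t => Cmod (K x t - K_N l Rk N x t)%C) 0 x.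

(* Main.v *)
Require Import Defs.
From Stdlib Require Import Lra Lia.
Open Scope R_scope.
Set Bullet Behavior "Strict Subproofs".

(** For [w <> 0] both [u w] and [utilde w] solve the perturbed Bessel equation and
    are asymptotic to multiples of [x^(l+1)] at [0], so they are proportional: their
    Wronskian is a constant [W], and the difference quotient [d / v], which tends to
    [0], has derivative [- W / v^2] of order [x^(-2l-2)], forcing [W = 0]; hence the
    difference vanishes near [0], and by Gronwall's inequality everywhere.
    With [S t = sqrt (w t) J (w t)], rescaling gives
    [u w x = S x + int_0^x K x t * S t dt], while [u_N] is the same expression with
    [K_N] in place of [K]. Subtracting, [|S| <= c_l] yields the estimate, uniformly
    in [w]. For [w = 0] both functions vanish. *)

(** * Derivatives of complex-valued functions *)

(** The asymptotics at [0] constrain the values of [u w] and [utilde], not their derivatives, so the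
    Wronskian cannot be evaluated as a limit at [0]; this is why the quotient [d / v] is examined
    instead. The potential [l (l + 1) / x^2] is unbounded at [0], so Gronwall's inequality has to
    start at an interior point; at [b] derivatives are one-sided, so equality there comes from left
    continuity. The factor between the two solutions is [w^(l+1) / (2^(l+1/2) Gamma(l+3/2))], the
    ratio of their prescribed asymptotics. Rescaling on principal branches works for negative [w]
    too, because a positive factor [t] never changes the argument. It also yields [S t = A * g t]
    with [A] a complex constant and [g] real and continuous on the whole line, so the integrands are
    continuous even at [0]. A lower bound on the improper integral [Gamma] serves twice: the factor
    is well defined, and the Bessel series converges everywhere. *)

Definition is_Cderive (f : R -> C) (x : R) (d : C) : Prop :=
  is_derive (fun t => Re (f t)) x (Re d) /\ is_derive (fun t => Im (f t)) x (Im d).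

(** Near an interior point the restriction to [D] is vacuous, so the derivative is two-sided.
    Passing to components makes the real mean value theorem available. *)
Lemma is_derive_on_interior (D : R -> Prop) (f : R -> C) (x : R) (d : C) :
  locally x D -> is_derive_on D f x d -> is_Cderive f x d.
Proof.
intros HD [Hl Hd].
assert (H : is_derive (V := C_R_NormedModule) f x d).
{ split; [exact Hl|].
  intros x' Hx' eps.
  assert (Hw : is_filter_lim (T := R_UniformSpace) (within D (locally x)) x').
  { intros P HP. apply filter_le_within, Hx', HP. }
  generalize (filter_and _ _ HD (Hd x' Hw eps)).
  apply filter_imp. intros y [Hy1 Hy2]. apply Hy2, Hy1. }
split.
- apply (filterdiff_comp' f fst x _ fst H), filterdiff_linear, is_linear_fst.
- apply (filterdiff_comp' f snd x _ snd H), filterdiff_linear, is_linear_snd.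
Qed.

Lemma is_Cderive_minus (f g : R -> C) (x : R) (df dg : C) :
  is_Cderive f x df -> is_Cderive g x dg ->
  is_Cderive (fun t => f t - g t)%C x (df - dg)%C.
Proof.
intros [Hf1 Hf2] [Hg1 Hg2].
split; apply (is_derive_minus (V := R_NormedModule)); assumption.
Qed.

Lemma is_Cderive_mult (f g : R -> C) (x : R) (df dg : C) :
  is_Cderive f x df -> is_Cderive g x dg ->
  is_Cderive (fun t => f t * g t)%C x (df * g x + f x * dg)%C.
Proof.
intros [Hf1 Hf2] [Hg1 Hg2]; split.
- apply (is_derive_ext (fun t => minus (Re (f t) * Re (g t)) (Im (f t) * Im (g t)))).
  { intros t; reflexivity. }
  evar_last.
  { apply (is_derive_minus (V := R_NormedModule));
      apply (is_derive_mult (K := R_AbsRing)); try eassumption; exact Rmult_comm. }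
  unfold minus, plus, opp, mult, Re, Im; simpl; ring.
- apply (is_derive_ext (fun t => plus (Re (f t) * Im (g t)) (Im (f t) * Re (g t)))).
  { intros t; reflexivity. }
  evar_last.
  { apply (is_derive_plus (V := R_NormedModule));
      apply (is_derive_mult (K := R_AbsRing)); try eassumption; exact Rmult_comm. }
  unfold minus, plus, opp, mult, Re, Im; simpl; ring.
Qed.

Lemma is_Cderive_const (c : C) (x : R) : is_Cderive (fun _ => c) x (RtoC 0).
Proof. split; apply (is_derive_const (V := R_NormedModule)). Qed.

Lemma is_Cderive_inv (f : R -> C) (x : R) (df : C) :
  f x <> RtoC 0 -> is_Cderive f x df ->
  is_Cderive (fun t => / f t)%C x (- df / (f x * f x))%C.
Proof.
intros H0 [H1 H2].
assert (Hm : (Re (f x))^2 + (Im (f x))^2 <> 0).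
{ intros E. apply H0.
  assert (Re (f x) = 0) by nra. assert (Im (f x) = 0) by nra.
  destruct (f x) as [u v]; simpl in *; subst; reflexivity. }
destruct (f x) as [u v] eqn:Ef; simpl in *.
(* This is the squared modulus of [f x * f x], a denominator that [field] meets when the complex
   quotient is expanded; it equals [(u^2 + v^2)^2]. *)
assert (Hm2 : (u * u - v * v)^2 + (u * v + v * u)^2 <> 0).
{ replace ((u * u - v * v)^2 + (u * v + v * u)^2) with ((u^2+v^2)^2) by ring.
  apply pow_nonzero. simpl in *. exact Hm. }
assert (E1 : Re (f x) = u) by (rewrite Ef; reflexivity).
assert (E2 : Im (f x) = v) by (rewrite Ef; reflexivity).
split.
- evar_last.
  { apply (is_derive_ext (fun t => Re (f t) / (Re (f t) ^ 2 + Im (f t) ^ 2))).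
    { intros t; reflexivity. }
    apply is_derive_div; [exact H1| |rewrite E1, E2; exact Hm].
    apply (is_derive_plus (V := R_NormedModule)); apply is_derive_pow; [exact H1|exact H2]. }
  cbv beta; rewrite E1, E2; destruct df as [p q]; unfold plus, Re, Im; simpl. field.
  repeat split; simpl in *; (exact Hm || (intros E; apply Hm2; rewrite <- E; ring) || (intros E; apply Hm; rewrite <- E; ring)).
- evar_last.
  { apply (is_derive_ext (fun t => (- Im (f t)) / (Re (f t) ^ 2 + Im (f t) ^ 2))).
    { intros t; reflexivity. }
    apply is_derive_div; [apply (is_derive_opp (V := R_NormedModule)); exact H2| |rewrite E1, E2; exact Hm].
    apply (is_derive_plus (V := R_NormedModule)); apply is_derive_pow; [exact H1|exact H2]. }
  cbv beta; rewrite E1, E2; destruct df as [p q]; unfold plus, opp, Re, Im; simpl. field.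
  repeat split; simpl in *; (exact Hm || (intros E; apply Hm2; rewrite <- E; ring) || (intros E; apply Hm; rewrite <- E; ring)).
Qed.

Lemma is_derive_zero_const (f : R -> R) (a b : R) :
  (forall x, a < x < b -> is_derive f x 0) ->
  forall x y, a < x < b -> a < y < b -> f x = f y.
Proof.
intros H x y Hx Hy.
destruct (MVT_gen f x y (fun _ => 0)) as [c [_ Hc]].
- intros z Hz. apply H. unfold Rmin, Rmax in Hz; destruct (Rle_dec x y); lra.
- intros z Hz. apply continuity_pt_filterlim, (ex_derive_continuous (V := R_NormedModule)).
  exists 0. apply H. unfold Rmin, Rmax in Hz; destruct (Rle_dec x y); lra.
- lra.
Qed.

Lemma is_Cderive_zero_const (f : R -> C) (a b : R) :
  (forall x, a < x < b -> is_Cderive f x (RtoC 0)) ->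
  forall x y, a < x < b -> a < y < b -> f x = f y.
Proof.
intros H x y Hx Hy. apply injective_projections.
- apply (is_derive_zero_const (fun t => Re (f t)) a b); auto. apply H.
- apply (is_derive_zero_const (fun t => Im (f t)) a b); auto. apply H.
Qed.

(** The weight [exp (- k * t)] turns [E' <= k E] into a nonpositive derivative of [F], so
    [F x <= F x0 = 0], while [E >= 0]. *)
Lemma gronwall_zero (E dE : R -> R) (k a b x0 : R) :
  (forall x, a < x < b -> is_derive E x (dE x)) ->
  (forall x, a < x < b -> 0 <= E x /\ dE x <= k * E x) ->
  a < x0 < b -> E x0 = 0 -> forall x, x0 <= x < b -> E x = 0.
Proof.
intros HE Hk Hx0 E0 x Hx.
pose (F := fun t => E t * exp (- k * t)).
assert (HF : forall t, a < t < b -> is_derive F t ((dE t - k * E t) * exp (- k * t))).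
{ intros t Ht. unfold F. evar_last.
  { apply (is_derive_mult (K := R_AbsRing)); [apply HE, Ht| |exact Rmult_comm].
    apply (is_derive_comp (V := R_NormedModule) exp (fun t => - k * t)).
    - apply is_derive_Reals, derivable_pt_lim_exp.
    - apply (is_derive_scal (fun t : R => t)), (is_derive_id (K := R_AbsRing)). }
  unfold plus, mult, scal, one; simpl; unfold mult; simpl; ring. }
destruct (MVT_gen F x0 x (fun t => (dE t - k * E t) * exp (- k * t))) as [c [Hc1 Hc2]].
- intros t Ht. rewrite Rmin_left, Rmax_right in Ht by lra. apply HF; lra.
- intros t Ht. rewrite Rmin_left, Rmax_right in Ht by lra.
  apply continuity_pt_filterlim, (ex_derive_continuous (V := R_NormedModule)).
  eexists; apply (HF t); split; lra.
- rewrite Rmin_left, Rmax_right in Hc1 by lra.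
  destruct (Hk c) as [_ H1]; [lra|]. destruct (Hk x) as [H2 _]; [lra|].
  assert (F x0 = 0) by (unfold F; rewrite E0; ring).
  assert (F x <= 0).
  { assert ((dE c - k * E c) * exp (- k * c) <= 0)
      by (generalize (exp_pos (- k * c)); intros; nra).
    nra. }
  unfold F in *. generalize (exp_pos (- k * x)); intros. nra.
Qed.

(** Multiplying [G] by the conjugate of [w] aligns its derivative with the real axis: the real part
    [h] grows at rate [|w|^2 Re H], at least [|w|^2 / (8 x^2)] on [[x, 2x]], yet [|h| <= |w|]. For
    small [x] the increment over [[x, 2x]] exceeds [2 |w|] unless [w] is zero. *)
Lemma derive_blowup_coeff_zero (G H : R -> C) (w : C) (d : R) :
  0 < d ->
  (forall x, 0 < x < d -> is_Cderive G x (w * H x)%C) ->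
  (forall x, 0 < x < d -> / (2 * x ^ 2) <= Re (H x)) ->
  (forall x, 0 < x < d -> Cmod (G x) <= 1) ->
  w = RtoC 0.
Proof.
intros Hd HG HH HB.
apply Cmod_eq_0.
destruct (Cmod_ge_0 w) as [Hw|<-]; [exfalso|reflexivity].
(* [d / 3] keeps [[x, 2x]] inside [(0, d)]; [Cmod w / 32] forces an increment of at least [4 |w|],
   against the allowed [2 |w|]. *)
pose (x := Rmin (d / 3) (Cmod w / 32)).
assert (Hx0 : 0 < x) by (apply Rmin_case; lra).
assert (Hx1 : x <= d / 3) by apply Rmin_l.
assert (Hx2 : x <= Cmod w / 32) by apply Rmin_r.
pose (h := fun t => Re (Cconj w * G t)%C).
assert (Hh : forall t, 0 < t < d -> is_derive h t (Cmod w ^ 2 * Re (H t))).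
{ intros t Ht. unfold h.
  destruct (is_Cderive_mult (fun _ => Cconj w) G t _ _ (is_Cderive_const _ t) (HG t Ht)) as [D _].
  evar_last; [exact D|].
  rewrite Cmod2_alt. unfold Re, Im; destruct w, (H t), (G t); simpl; ring. }
assert (Hb : forall t, 0 < t < d -> Rabs (h t) <= Cmod w).
{ intros t Ht. unfold h. eapply Rle_trans; [apply re_le_Cmod|].
  rewrite Cmod_mult, Cmod_conj. specialize (HB t Ht). nra. }
destruct (MVT_gen h x (2 * x) (fun t => Cmod w ^ 2 * Re (H t))) as [c [Hc1 Hc2]].
- intros t Ht. rewrite Rmin_left, Rmax_right in Ht by lra. apply Hh; lra.
- intros t Ht. rewrite Rmin_left, Rmax_right in Ht by lra.
  apply continuity_pt_filterlim, (ex_derive_continuous (V := R_NormedModule)).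
  eexists; apply (Hh t); split; lra.
- rewrite Rmin_left, Rmax_right in Hc1 by lra.
  assert (L : / (8 * x ^ 2) <= Re (H c)).
  { eapply Rle_trans; [|apply HH; lra]. apply Rinv_le_contravar; nra. }
  assert (B1 := Hb x ltac:(lra)). assert (B2 := Hb (2 * x) ltac:(lra)).
  apply Rabs_le_between in B1. apply Rabs_le_between in B2.
  assert (L2 : Cmod w ^ 2 * (/ (8 * x ^ 2)) * x <= 2 * Cmod w).
  { replace (2 * x - x) with x in Hc2 by ring.
    assert (0 <= Cmod w ^ 2) by nra.
    assert (Cmod w ^ 2 * / (8 * x ^ 2) <= Cmod w ^ 2 * Re (H c)) by (apply Rmult_le_compat_l; lra).
    nra. }
  replace (Cmod w ^ 2 * / (8 * x ^ 2) * x) with (Cmod w * (Cmod w / (8 * x))) in L2 by (field; lra).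
  assert (4 <= Cmod w / (8 * x)) by (rewrite <- Rle_div_r; lra).
  nra.
Qed.

Lemma equiv_at_0_near (f g : R -> C) (eps : R) :
  0 < eps -> equiv_at_0 f g ->
  exists d, 0 < d /\ forall x, 0 < x < d ->
    Rabs (Re (f x / g x)%C - 1) < eps /\ Rabs (Im (f x / g x)%C) < eps.
Proof.
intros He Hf.
destruct (Hf _ (locally_ball (RtoC 1) (mkposreal eps He))) as [d Hd].
exists d. split; [apply cond_pos|]. intros x Hx.
destruct (Hd x) as [H1 H2].
- unfold ball; simpl; unfold AbsRing_ball, abs, minus, plus, opp; simpl.
  rewrite Ropp_0, Rplus_0_r, Rabs_pos_eq; lra.
- lra.
- split; [exact H1|].
  revert H2. unfold ball; simpl; unfold AbsRing_ball, abs, minus, plus, opp; simpl.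
  rewrite Ropp_0, Rplus_0_r. auto.
Qed.

(** With [s = u + i v] the real part is [(u^2 - v^2) / (u^2 + v^2)^2]. At tolerance [1/10] the
    numerator is at least [0.8] and half the denominator at most [0.7442]. *)
Lemma Re_inv_sqr_near_1 (s : C) :
  Rabs (Re s - 1) < 1 / 10 -> Rabs (Im s) < 1 / 10 -> 1 / 2 <= Re (/ (s * s))%C.
Proof.
intros H1 H2. apply Rabs_def2 in H1. apply Rabs_def2 in H2.
destruct s as [u v]; unfold Re, Im in *; cbn [fst snd] in *.
assert (B : 1 / 2 * (u ^ 2 + v ^ 2) ^ 2 <= u ^ 2 - v ^ 2).
{ assert (0 <= u ^ 2 <= 121 / 100) by nra. assert (0 <= v ^ 2 <= 1 / 100) by nra.
  assert (81 / 100 <= u ^ 2) by nra. nra. }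
replace (fst (/ ((u, v) * (u, v)))%C) with ((u ^ 2 - v ^ 2) / (u ^ 2 + v ^ 2) ^ 2).
- rewrite <- Rle_div_r; [exact B|]. apply pow_lt. nra.
- assert (0 < u ^ 2 + v ^ 2) by nra.
  assert (0 < (u ^ 2 + v ^ 2) ^ 2) by (apply pow_lt; assumption).
  simpl. field. split; intros E0; nra.
Qed.

(** Adding [(M + p) (a - c)^2] and [(M - p) (a + c)^2], both nonnegative, gives twice the difference
    of the two sides. *)
Lemma mult_le_sum_sqr (M p a c : R) : Rabs p <= M -> 2 * (p * a * c) <= M * (a ^ 2 + c ^ 2).
Proof.
intros H. apply Rabs_le_between in H.
assert (0 <= (M + p) * (a - c) ^ 2) by (apply Rmult_le_pos; [lra|apply pow2_ge_0]).
assert (0 <= (M - p) * (a + c) ^ 2) by (apply Rmult_le_pos; [lra|apply pow2_ge_0]).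
nra.
Qed.

(** Gronwall for the energy [|d|^2 + |dd|^2]. In the rate [1 + 2 * M], the [1] bounds the products
    of [d] with [dd], and [2 * M] the four products involving a component of [Q], each component
    being at most [M] in absolute value. *)
Lemma second_order_zero (d dd Q : R -> C) (a b x0 M : R) :
  (forall x, a < x < b ->
     is_Cderive d x (dd x) /\ is_Cderive dd x (Q x * d x)%C /\ Cmod (Q x) <= M) ->
  a < x0 < b -> d x0 = RtoC 0 -> dd x0 = RtoC 0 ->
  forall x, x0 <= x < b -> d x = RtoC 0.
Proof.
intros H Hx0 E0 E1 x Hx.
pose (E := fun t => (Re (d t) ^ 2 + Im (d t) ^ 2) + (Re (dd t) ^ 2 + Im (dd t) ^ 2)).
assert (HE : E x = 0).
{ refine (gronwall_zero E (fun t =>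
    (2 * (Re (dd t) * Re (d t)) + 2 * (Im (dd t) * Im (d t))) +
    (2 * (Re (Q t * d t)%C * Re (dd t)) + 2 * (Im (Q t * d t)%C * Im (dd t))))
    (1 + 2 * M) a b x0 _ _ Hx0 _ x Hx).
  - intros t Ht. destruct (H t Ht) as [[D1 D2] [[D3 D4] _]].
    unfold E. evar_last.
    { apply (is_derive_plus (V := R_NormedModule)); apply (is_derive_plus (V := R_NormedModule));
      apply is_derive_pow; eassumption. }
    unfold plus, Re, Im; simpl; ring.
  - intros t Ht. destruct (H t Ht) as [_ [_ HM]].
    split; [unfold E; nra|].
    assert (M1 := Rle_trans _ _ _ (re_le_Cmod (Q t)) HM).
    assert (M2 := Rle_trans _ _ _ (Rle_trans _ _ _ (Rmax_r _ _) (Rmax_Cmod (Q t))) HM).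
    unfold E. destruct (Q t) as [q1 q2], (d t) as [a1 a2], (dd t) as [c1 c2].
    unfold Re, Im in *; cbn [fst snd Cmult] in *.
    assert (I1 := mult_le_sum_sqr M q1 a1 c1 M1). assert (I2 := mult_le_sum_sqr M q1 a2 c2 M1).
    assert (I3 := mult_le_sum_sqr M q2 a1 c2 M2).
    assert (I4 := mult_le_sum_sqr M q2 a2 (- c1) M2).
    assert (0 <= (a1 - c1) ^ 2) by apply pow2_ge_0.
    assert (0 <= (a2 - c2) ^ 2) by apply pow2_ge_0.
    nra.
  - unfold E. rewrite E0, E1. unfold Re, Im; simpl; ring. }
unfold E in HE.
assert (Re (d x) = 0) by nra. assert (Im (d x) = 0) by nra.
destruct (d x) as [u v]; unfold Re, Im in *; simpl in *; subst; reflexivity.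
Qed.

Lemma Rabs_clamp_le (a b x y : R) :
  Rabs (Rmax a (Rmin b y) - Rmax a (Rmin b x)) <= Rabs (y - x).
Proof.
unfold Rmax, Rmin.
destruct (Rle_dec b x), (Rle_dec b y);
  repeat destruct (Rle_dec _ _); unfold Rabs; repeat destruct (Rcase_abs _); lra.
Qed.

(** The clamp onto [[a, b]] is 1-Lipschitz, so composing with it gives an extension continuous on
    the whole line. Integrability criteria that ask for two-sided continuity at the endpoints then
    apply. *)
Lemma continuous_clamp (U : UniformSpace) (a b : R) (f : R -> U) :
  a <= b ->
  continuous_on (T := R_UniformSpace) (fun x => a <= x <= b) f ->
  forall x, continuous (T := R_UniformSpace) (fun t => f (Rmax a (Rmin b t))) x.
Proof.
intros Hab Hf x.
assert (Hc : forall t, a <= Rmax a (Rmin b t) <= b).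
{ intros t. split; [apply Rmax_l|]. apply Rmax_lub; [exact Hab|apply Rmin_l]. }
apply (filterlim_comp _ _ _ (fun t => Rmax a (Rmin b t)) f (locally x)
  (within (fun x => a <= x <= b) (locally (T := R_UniformSpace) (Rmax a (Rmin b x))))).
- intros P [e He]. exists e. intros y Hy. apply He; [|apply Hc].
  eapply Rle_lt_trans; [apply Rabs_clamp_le|exact Hy].
- apply Hf, Hc.
Qed.

Lemma norm_C_R (z : C) : norm (V := C_R_NormedModule) z = Cmod z.
Proof.
destruct z as [u v]. unfold norm, Cmod; simpl. unfold prod_norm, norm; simpl.
unfold abs; simpl. rewrite !Rmult_1_r. f_equal.
rewrite <- !Rabs_mult, !Rabs_pos_eq; nra.
Qed.

Lemma clamp_id (a b x : R) : a <= x <= b -> Rmax a (Rmin b x) = x.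
Proof. intros H. rewrite Rmin_right, Rmax_right; lra. Qed.

Lemma continuous_on_segment_bounded (a b : R) (f : R -> C) :
  a <= b ->
  continuous_on (T := R_UniformSpace) (U := C_UniformSpace) (fun x => a <= x <= b) f ->
  exists M, forall x, a <= x <= b -> Cmod (f x) <= M.
Proof.
intros Hab Hf.
destruct (bounded_continuity (V := C_R_NormedModule) (fun t => f (Rmax a (Rmin b t))) a b) as [M HM].
- intros x _. apply (continuous_clamp C_UniformSpace a b f Hab Hf).
- exists M. intros x Hx. specialize (HM x Hx). cbv beta in HM. rewrite norm_C_R, clamp_id in HM; lra.
Qed.

(** * Uniqueness of the regular solution *)

Lemma locally_half_open (b x : R) : 0 < x < b -> locally x (half_open b).
Proof.
intros Hx.
assert (He : 0 < Rmin x (b - x)) by (apply Rmin_case; lra).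
exists (mkposreal _ He). intros y Hy.
apply Rabs_def2 in Hy. simpl in Hy.
assert (Rmin x (b - x) <= x) by apply Rmin_l.
assert (Rmin x (b - x) <= b - x) by apply Rmin_r.
unfold minus, plus, opp in Hy; simpl in Hy. split; lra.
Qed.

Lemma Cmod_le_sum (z : C) : Cmod z <= Rabs (Re z) + Rabs (Im z).
Proof.
destruct z as [u v]. unfold Cmod, Re, Im; simpl.
rewrite <- (sqrt_pow2 (Rabs u + Rabs v)).
- apply sqrt_le_1_alt. rewrite !Rmult_1_r.
  assert (H1 := pow2_abs u). assert (H2 := pow2_abs v).
  assert (0 <= Rabs u) by apply Rabs_pos. assert (0 <= Rabs v) by apply Rabs_pos. nra.
- apply Rplus_le_le_0_compat; apply Rabs_pos.
Qed.

Lemma RtoC_pow_neq_0 (x : R) (n : nat) : 0 < x -> RtoC (x ^ n) <> RtoC 0.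
Proof. intros Hx E. apply RtoC_inj in E. revert E. apply pow_nonzero; lra. Qed.

(** With [s = v / x^n] and [r = y / (c x^n)], both near [1], the last quotient is [c (r - s) / s].
    The lower bound on the real part is the blow-up needed for [1 / v^2]. *)
Lemma equiv_at_0_quotient_small (n : nat) (c : C) (y v : R -> C) (eps : R) :
  c <> RtoC 0 -> 0 < eps ->
  equiv_at_0 v (fun x => RtoC (x ^ n)) ->
  equiv_at_0 y (fun x => (c * RtoC (x ^ n))%C) ->
  exists d, 0 < d /\ forall x, 0 < x < d ->
    v x <> RtoC 0 /\ 1 / 2 <= Re (/ ((v x / x ^ n) * (v x / x ^ n)))%C /\
    Cmod ((y x - c * v x) / v x)%C <= eps.
Proof.
intros Hc He Hv Hy.
assert (Hc0 := Cmod_ge_0 c).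
(* [1/10] is the tolerance of [Re_inv_sqr_near_1] and keeps [|s| >= 9/10]; the other term gives
   [|c| * 4e <= eps / 2], where [4e] bounds [|r - s|]. *)
pose (e := Rmin (1 / 10) (eps / (8 * (Cmod c + 1)))).
assert (Hq : 0 < eps / (8 * (Cmod c + 1))) by (apply Rdiv_lt_0_compat; lra).
assert (He0 : 0 < e) by (apply Rmin_case; lra).
assert (He1 : e <= 1 / 10) by apply Rmin_l.
assert (He2 : e * (8 * (Cmod c + 1)) <= eps).
{ apply Rle_div_r; [lra|]. apply Rmin_r. }
destruct (equiv_at_0_near _ _ e He0 Hv) as [d1 [Hd1 H1]].
destruct (equiv_at_0_near _ _ e He0 Hy) as [d2 [Hd2 H2]].
exists (Rmin d1 d2). split; [apply Rmin_case; assumption|].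
intros x Hx.
assert (Hxd1 := Rmin_l d1 d2). assert (Hxd2 := Rmin_r d1 d2).
destruct (H1 x) as [A1 A2]; [lra|]. destruct (H2 x) as [B1 B2]; [lra|].
assert (Hp := RtoC_pow_neq_0 x n ltac:(lra)).
rewrite RtoC_pow in *.
assert (Hv0 : v x <> RtoC 0).
{ intros E. rewrite E in A1. apply Rabs_def2 in A1.
  replace (RtoC 0 / RtoC x ^ n)%C with (RtoC 0) in A1 by (field; exact Hp). simpl in A1. lra. }
split; [exact Hv0|]. split.
{ apply Re_inv_sqr_near_1; lra. }
set (s := (v x / RtoC x ^ n)%C) in *. set (r := (y x / (c * RtoC x ^ n))%C) in *.
replace ((y x - c * v x) / v x)%C with (c * (r - s) / s)%C
  by (unfold r, s; field; repeat split; assumption).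
assert (Hs : 9 / 10 <= Cmod s).
{ eapply Rle_trans; [|apply re_le_Cmod]. apply Rabs_def2 in A1.
  eapply Rle_trans; [|apply Rle_abs]. lra. }
assert (Hs0 : s <> RtoC 0) by (intros E; rewrite E, Cmod_0 in Hs; lra).
assert (Hrs : Cmod (r - s)%C <= 4 * e).
{ eapply Rle_trans; [apply Cmod_le_sum|].
  apply Rabs_def2 in A1. apply Rabs_def2 in A2. apply Rabs_def2 in B1. apply Rabs_def2 in B2.
  assert (Rabs (Re (r - s)%C) <= 2 * e) by (apply Rabs_le; change (Re (r - s)%C) with (Re r - Re s); lra).
  assert (Rabs (Im (r - s)%C) <= 2 * e) by (apply Rabs_le; change (Im (r - s)%C) with (Im r - Im s); lra).
  lra. }
rewrite Cmod_div, Cmod_mult by assumption.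
apply Rle_div_l; [lra|].
assert (0 <= Cmod (r - s)%C) by apply Cmod_ge_0.
nra.
Qed.

Lemma solves_Bessel_interior (l : nat) (q : R -> C) (b : R) (w : C) (y : R -> C) :
  solves_Bessel l q b w y ->
  exists dy : R -> C, forall x, 0 < x < b ->
    is_Cderive y x (dy x) /\
    is_Cderive dy x ((RtoC (INR l * (INR l + 1) / x ^ 2) + q x - w ^ 2) * y x)%C.
Proof.
intros [dy [ddy H]]. exists dy. intros x Hx.
assert (L := locally_half_open b x Hx).
destruct (H x) as [H1 [H2 H3]]; [split; lra|].
split; [apply (is_derive_on_interior _ _ _ _ L H1)|].
replace ((RtoC (INR l * (INR l + 1) / x ^ 2) + q x - w ^ 2) * y x)%C with (ddy x).
- apply (is_derive_on_interior _ _ _ _ L H2).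
- set (Q := RtoC _) in *.
  replace ((Q + q x - w ^ 2) * y x)%C with ((- ddy x + (Q + q x) * y x) - w ^ 2 * y x + ddy x)%C by ring.
  rewrite H3. ring.
Qed.

Lemma is_derive_on_continuous (D : R -> Prop) (f : R -> C) (x : R) (d : C) :
  D x -> is_derive_on D f x d ->
  filterlim f (within D (locally x)) (locally (T := C_UniformSpace) (f x)).
Proof.
intros Dx H.
apply (filterdiff_continuous_aux (K := R_AbsRing) (U := R_NormedModule) (V := C_R_NormedModule)
  (F := within D (locally x))).
- eexists; exact H.
- intros P HP. apply filter_le_within, HP.
Qed.

(** Differentiability along [half_open b] at the endpoint gives left continuity, which later carries
    an identity on [(0, b)] over to [b]. *)
Lemma solves_Bessel_left_limit (l : nat) (q : R -> C) (b : R) (w : C) (y : R -> C) :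
  0 < b -> solves_Bessel l q b w y ->
  filterlim y (at_left b) (locally (T := C_UniformSpace) (y b)).
Proof.
intros Hb [dy [ddy H]].
destruct (H b) as [H1 _]; [split; lra|].
apply (filterlim_filter_le_1 _ (F := within (half_open b) (locally b))).
- intros P HP. unfold at_left, within in *.
  assert (Hp : locally b (fun x => 0 < x)) by (apply (open_gt 0 b Hb)).
  generalize (filter_and _ _ Hp HP). apply filter_imp.
  intros x [Hx1 Hx2] Hx3. apply Hx2. split; lra.
- apply (is_derive_on_continuous _ _ _ _ (conj Hb (Rle_refl b)) H1).
Qed.

Lemma solves_Bessel_proportional (l : nat) (q : R -> C) (b : R) (w c : C) (y v : R -> C) :
  0 < b -> (exists M, forall x, half_open b x -> Cmod (q x) <= M) ->
  solves_Bessel l q b w y -> solves_Bessel l q b w v -> c <> RtoC 0 ->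
  equiv_at_0 v (fun x => RtoC (x ^ (l + 1))) ->
  equiv_at_0 y (fun x => (c * RtoC (x ^ (l + 1)))%C) ->
  forall x, half_open b x -> y x = (c * v x)%C.
Proof.
intros Hb [M HM] Sy Sv Hc Ev Ey.
destruct (solves_Bessel_interior l q b w y Sy) as [dy Dy].
destruct (solves_Bessel_interior l q b w v Sv) as [dv Dv].
set (Q := fun x => (RtoC (INR l * (INR l + 1) / x ^ 2) + q x - w ^ 2)%C).
pose (d := fun x => (y x - c * v x)%C). pose (dd := fun x => (dy x - c * dv x)%C).
assert (D1 : forall x, 0 < x < b -> is_Cderive d x (dd x)).
{ intros x Hx. destruct (Dy x Hx) as [Hy _]. destruct (Dv x Hx) as [Hv _].
  unfold d, dd. apply is_Cderive_minus; [exact Hy|].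
  replace (c * dv x)%C with (RtoC 0 * v x + c * dv x)%C by ring.
  apply (is_Cderive_mult (fun _ => c)); [apply is_Cderive_const|exact Hv]. }
assert (D2 : forall x, 0 < x < b -> is_Cderive dd x (Q x * d x)%C).
{ intros x Hx. destruct (Dy x Hx) as [_ Hy]. destruct (Dv x Hx) as [_ Hv].
  unfold dd. replace (Q x * d x)%C with (Q x * y x - (RtoC 0 * dv x + c * (Q x * v x)))%C
    by (unfold d; ring).
  apply is_Cderive_minus; [exact Hy|].
  apply (is_Cderive_mult (fun _ => c)); [apply is_Cderive_const|exact Hv]. }
(* The Wronskian of [d] and [v]: both satisfy the same equation [f'' = Q f], so the terms of its
   derivative cancel. *)
pose (W := fun x => (d x * dv x - dd x * v x)%C).
assert (DW : forall x, 0 < x < b -> is_Cderive W x (RtoC 0)).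
{ intros x Hx. destruct (Dv x Hx) as [Hv1 Hv2].
  replace (RtoC 0) with ((dd x * dv x + d x * (Q x * v x)) - (Q x * d x * v x + dd x * dv x))%C by ring.
  unfold W. apply is_Cderive_minus; apply is_Cderive_mult; auto. }
set (W0 := W (b / 2)).
assert (HW : forall x, 0 < x < b -> W x = W0).
{ intros x Hx. apply (is_Cderive_zero_const W 0 b DW); lra. }
(* Tolerance [1] supplies the bound [Cmod (G x) <= 1] of the blow-up argument; arbitrarily small
   tolerances are used only once [G] is known to be constant. *)
destruct (equiv_at_0_quotient_small (l + 1) c y v 1 Hc Rlt_0_1 Ev Ey) as [e0 [He0 H0]].
pose (e := Rmin e0 (Rmin b 1)).
assert (He : 0 < e) by (repeat apply Rmin_case; lra).
assert (Hee0 : e <= e0) by apply Rmin_l.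
assert (Heb : e <= b) by (eapply Rle_trans; [apply Rmin_r|apply Rmin_l]).
assert (He1 : e <= 1) by (eapply Rle_trans; [apply Rmin_r|apply Rmin_r]).
pose (G := fun x => (d x * / v x)%C).
assert (DG : forall x, 0 < x < e -> is_Cderive G x (- W0 * / (v x * v x))%C).
{ intros x Hx. destruct (H0 x) as [Hv0 _]; [lra|].
  destruct (Dv x) as [Hv _]; [lra|].
  replace (- W0 * / (v x * v x))%C with (dd x * / v x + d x * (- dv x / (v x * v x)))%C.
  - unfold G. apply is_Cderive_mult; [apply D1; lra|apply is_Cderive_inv; assumption].
  - rewrite <- (HW x) by lra. unfold W. field. exact Hv0. }
assert (HW0 : (- W0)%C = RtoC 0).
{ apply (derive_blowup_coeff_zero G (fun x => (/ (v x * v x))%C) (- W0)%C e He DG).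
  - intros x Hx. destruct (H0 x) as [Hv0 [Hs _]]; [lra|].
    assert (Hp := RtoC_pow_neq_0 x (l + 1) ltac:(lra)).
    assert (Hp0 : 0 < x ^ (l + 1)) by (apply pow_lt; lra).
    (* Here [e <= 1] is used. The rate [1 / x^2] is weaker than the true [1 / x^(2l+2)] but already
       non-integrable at [0], and it is the same for every [l]. *)
    assert (Hpx : x ^ (l + 1) <= x).
    { assert (x ^ l <= 1) by (rewrite <- (pow1 l); apply pow_incr; lra).
      rewrite pow_add, pow_1. nra. }
    rewrite <- RtoC_pow in Hs. set (p := x ^ (l + 1)) in *.
    replace (/ (v x * v x))%C with (/ ((v x / p) * (v x / p)) * RtoC (/ (p * p)))%C.
    + rewrite re_scal_r.
      replace (/ (2 * x ^ 2)) with (1 / 2 * / (x * x)) by (field; lra).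
      apply Rmult_le_compat; try lra.
      * left; apply Rinv_0_lt_compat; nra.
      * apply Rinv_le_contravar; nra.
    + rewrite RtoC_inv by nra. rewrite RtoC_mult. field. split; assumption.
  - intros x Hx. apply H0; lra. }
assert (CG : forall x x', 0 < x < e -> 0 < x' < e -> G x = G x').
{ apply is_Cderive_zero_const. intros t Ht.
  replace (RtoC 0) with (- W0 * / (v t * v t))%C by (rewrite HW0; ring). apply DG, Ht. }
assert (G0 : forall x, 0 < x < e -> G x = RtoC 0).
{ intros x Hx. apply Cmod_eq_0, Rle_antisym; [|apply Cmod_ge_0].
  apply le_epsilon. intros eps Heps.
  destruct (equiv_at_0_quotient_small (l + 1) c y v eps Hc Heps Ev Ey) as [e2 [He2 H2]].
  pose (x' := Rmin (e / 2) (e2 / 2)).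
  assert (0 < x') by (apply Rmin_case; lra).
  assert (x' <= e / 2) by apply Rmin_l. assert (x' <= e2 / 2) by apply Rmin_r.
  rewrite (CG x x'), Rplus_0_l by lra. apply H2. lra. }
assert (d0 : forall x, 0 < x < e -> d x = RtoC 0).
{ intros x Hx. destruct (H0 x) as [Hv0 _]; [lra|].
  replace (d x) with (G x * v x)%C by (unfold G; field; exact Hv0).
  rewrite G0 by exact Hx. ring. }
(* The second initial condition: [d] vanishes on a neighbourhood of [e / 2], so its derivative there
   does too. *)
assert (dd0 : dd (e / 2) = RtoC 0).
{ destruct (D1 (e / 2)) as [E1 E2]; [lra|].
  assert (L : locally (e / 2) (fun t => RtoC 0 = d t)).
  { generalize (locally_half_open e (e / 2) ltac:(lra)).
    assert (Hlt : locally (e / 2) (fun t => t < e)) by (apply (open_lt e); lra).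
    intros Hh. generalize (filter_and _ _ Hlt Hh). apply filter_imp.
    intros t [Ht1 [Ht2 _]]. symmetry. apply d0. lra. }
  apply injective_projections.
  - apply is_derive_unique in E1. change (Re (dd (e / 2)) = 0). rewrite <- E1.
    rewrite <- (Derive_const 0 (e / 2)). apply Derive_ext_loc.
    generalize L. apply filter_imp. intros t <-. reflexivity.
  - apply is_derive_unique in E2. change (Im (dd (e / 2)) = 0). rewrite <- E2.
    rewrite <- (Derive_const 0 (e / 2)). apply Derive_ext_loc.
    generalize L. apply filter_imp. intros t <-. reflexivity. }
assert (dall : forall x, 0 < x < b -> d x = RtoC 0).
{ intros x Hx. destruct (Rlt_le_dec x e) as [Hxe|Hxe]; [apply d0; lra|].
  (* Working to the right of [e / 4] keeps the singular potential bounded; the initial data are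
     taken at [e / 2], inside the region where [d] is already zero. *)
  apply (second_order_zero d dd Q (e / 4) b (e / 2)
    (INR l * (INR l + 1) / (e / 4) ^ 2 + M + Cmod (w ^ 2)%C)); [|lra|apply d0; lra|exact dd0|lra].
  intros t Ht. split; [apply D1; lra|]. split; [apply D2; lra|].
  unfold Q, Cminus. eapply Rle_trans; [apply Cmod_triangle|]. rewrite Cmod_opp.
  apply Rplus_le_compat_r. eapply Rle_trans; [apply Cmod_triangle|].
  apply Rplus_le_compat; [|apply HM; split; lra].
  assert (Hl := pos_INR l).
  rewrite Cmod_R, Rabs_pos_eq.
  - apply Rmult_le_compat_l; [nra|]. apply Rinv_le_contravar; nra.
  - apply Rmult_le_pos; [nra|]. left; apply Rinv_0_lt_compat; nra. }
assert (yv : forall x, 0 < x < b -> y x = (c * v x)%C).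
{ intros x Hx. replace (y x) with (d x + c * v x)%C by (unfold d; ring).
  rewrite dall by exact Hx. ring. }
intros x [Hx1 Hx2].
destruct (Rle_lt_or_eq_dec x b Hx2) as [Hlt| ->]; [apply yv; lra|].
apply (filterlim_locally_unique (K := C_AbsRing) (V := C_NormedModule) (F := at_left b) y).
- apply (solves_Bessel_left_limit l q b w y Hb Sy).
- apply (filterlim_ext_loc (fun t => (c * v t)%C)).
  + assert (Hp : locally b (fun t => 0 < t)) by (apply (open_gt 0 b Hb)).
    revert Hp. apply (filter_imp (F := locally b)). intros t Ht1 Ht2. symmetry. apply yv. lra.
  + apply (filterlim_comp _ _ _ v (fun z => (c * z)%C) _ (locally (T := C_UniformSpace) (v b))).
    * apply (solves_Bessel_left_limit l q b w v Hb Sv).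
    * apply (filterlim_scal_r (K := C_AbsRing) (V := C_NormedModule)).
Qed.

(** * The Gamma function and the Bessel series *)

Lemma ex_RInt_pos (f : R -> R) (a B : R) :
  (forall t, 0 < t -> continuous f t) -> 0 < a -> 0 < B -> ex_RInt f a B.
Proof.
intros Hf Ha HB. apply (ex_RInt_continuous (V := R_CompleteNormedModule)).
intros z Hz. apply Hf. assert (0 < Rmin a B) by (apply Rmin_case; assumption). lra.
Qed.

Lemma RInt_pos_incr (f : R -> R) (a a' B B' : R) :
  (forall t, 0 < t -> continuous f t) -> (forall t, 0 < t -> 0 <= f t) ->
  0 < a' <= a -> a <= B <= B' -> RInt f a B <= RInt f a' B'.
Proof.
intros Hc Hp Ha HB.
assert (E : forall x y, 0 < x -> 0 < y -> ex_RInt f x y) by (intros; apply ex_RInt_pos; auto).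
rewrite <- (RInt_Chasles f a' a B') by (apply E; lra).
rewrite <- (RInt_Chasles f a B B') by (apply E; lra).
assert (0 <= RInt f a' a) by (apply RInt_ge_0; [lra|apply E; lra|intros; apply Hp; lra]).
assert (0 <= RInt f B B') by (apply RInt_ge_0; [lra|apply E; lra|intros; apply Hp; lra]).
unfold plus; simpl; lra.
Qed.

(** The integrals over [[a, B]] grow with the interval, so their supremum is their limit. Keeping
    the comparison of every proper integral with [L] is what later bounds [Gamma] from below. *)
Lemma is_RInt_gen_nonneg_bounded (f : R -> R) (M : R) :
  (forall t, 0 < t -> continuous f t) -> (forall t, 0 < t -> 0 <= f t) ->
  (forall a B, 0 < a <= B -> RInt f a B <= M) ->
  exists L, is_RInt_gen f (at_right 0) (Rbar_locally p_infty) L /\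
            forall a B, 0 < a <= B -> RInt f a B <= L.
Proof.
intros Hc Hp HM.
destruct (completeness (fun z => exists a B, 0 < a <= B /\ z = RInt f a B)) as [L [HL1 HL2]].
- exists M. intros z [a [B [H ->]]]. apply HM, H.
- exists (RInt f 1 1), 1, 1. split; [lra|reflexivity].
- exists L.
  assert (HL : forall a B, 0 < a <= B -> RInt f a B <= L).
  { intros a B H. apply HL1. exists a, B. auto. }
  split; [|exact HL].
  intros P [eps HP].
  assert (Hex : exists a B, 0 < a <= B /\ L - eps < RInt f a B).
  { destruct (Classical_Prop.classic (exists a B, 0 < a <= B /\ L - eps < RInt f a B)) as [H|H]; [exact H|].
    exfalso. assert (L <= L - eps); [|destruct eps; simpl in *; lra].
    apply HL2. intros z [a [B [H1 ->]]]. apply Rnot_lt_le. intros H2. apply H. exists a, B. auto. }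
  destruct Hex as [a0 [B0 [H0 H1]]].
  exists (fun a => 0 < a < a0) (fun B => B0 < B).
  + assert (Ha0 : 0 < a0) by lra. exists (mkposreal a0 Ha0). intros y Hy Hy0.
    apply Rabs_def2 in Hy. unfold minus, plus, opp in Hy; simpl in Hy. split; lra.
  + exists B0. auto.
  + intros a B Ha HB. exists (RInt f a B). split.
    * apply (RInt_correct (V := R_CompleteNormedModule)). apply ex_RInt_pos; [exact Hc|simpl; lra..].
    * apply HP. apply Rabs_def1; unfold minus, plus, opp; simpl.
      -- assert (RInt f a B <= L) by (apply HL; lra). destruct eps; simpl in *; lra.
      -- assert (RInt f a0 B0 <= RInt f a B) by (apply RInt_pos_incr; auto; lra). lra.
Qed.

Lemma continuous_Gamma_integrand (s t : R) :
  0 < t -> continuous (fun t => Rpower t (s - 1) * exp (- t)) t.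
Proof.
intros Ht. apply (ex_derive_continuous (V := R_NormedModule)).
unfold Rpower. auto_derive. exact Ht.
Qed.

Lemma exp_le_mono (x y : R) : x <= y -> exp x <= exp y.
Proof. intros [H| ->]; [left; apply exp_increasing, H|apply Rle_refl]. Qed.

(** Apply [ln z <= z] at [z = t / (2y)]: then [y ln t <= y ln (2y) + t / 2]. This dominates the
    Gamma integrand by a multiple of [exp (- t / 2)]. *)
Lemma Rpower_le_exp (y t : R) :
  0 < y -> 0 < t -> Rpower t y <= exp (y * ln (2 * y)) * exp (t / 2).
Proof.
intros Hy Ht. rewrite <- exp_plus. unfold Rpower.
apply exp_le_mono.
replace t with ((2 * y) * (t / (2 * y))) at 1 by (field; lra).
assert (H : 0 < t / (2 * y)) by (apply Rdiv_lt_0_compat; lra).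
rewrite ln_mult by lra.
assert (ln (t / (2 * y)) <= t / (2 * y)).
{ rewrite <- (ln_exp (t / (2 * y))) at 2. apply ln_le; [exact H|].
  generalize (exp_ineq1_le (t / (2 * y))). lra. }
replace (t / 2) with (y * (t / (2 * y))) by (field; lra).
nra.
Qed.

Lemma is_RInt_exp_half (a B : R) :
  is_RInt (fun t => exp (- t / 2)) a B (2 * exp (- a / 2) - 2 * exp (- B / 2)).
Proof.
evar_last.
- apply (is_RInt_derive (V := R_CompleteNormedModule) (fun t => - 2 * exp (- t / 2)) (fun t => exp (- t / 2))).
  + intros t _. auto_derive; [exact I|]. unfold Rdiv. field.
  + intros t _. apply (ex_derive_continuous (V := R_NormedModule)). auto_derive. exact I.
- unfold minus, plus, opp; simpl. ring.
Qed.

(** Domination proves convergence, without which the value of [RInt_gen] says nothing. The bound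
    comes from [[1, 2]], where the power is at least [1] and the exponential at least [exp (-2)]; it
    is uniform in [s]. *)
Lemma Gamma_lower_bound (s : R) : 1 < s -> exp (- 2) <= Gamma s.
Proof.
intros Hs.
set (f := fun t => Rpower t (s - 1) * exp (- t)).
assert (Hc : forall t, 0 < t -> continuous f t) by (intros; apply continuous_Gamma_integrand; assumption).
set (K := exp ((s - 1) * ln (2 * (s - 1)))).
assert (HK : 0 < K) by apply exp_pos.
(* The [2] is the integral of [exp (- t / 2)] over the half-line. *)
destruct (is_RInt_gen_nonneg_bounded f (K * 2)) as [L [HL1 HL2]].
- exact Hc.
- intros t Ht. unfold f, Rpower. apply Rmult_le_pos; left; apply exp_pos.
- intros a B Hab.
  apply Rle_trans with (RInt (fun t => K * exp (- t / 2)) a B).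
  + apply RInt_le; [lra|apply ex_RInt_pos; [exact Hc|lra..]| |].
    * apply (ex_RInt_scal (V := R_NormedModule)). eexists; apply is_RInt_exp_half.
    * intros t Ht. unfold f.
      assert (H := Rpower_le_exp (s - 1) t ltac:(lra) ltac:(lra)).
      replace (exp (- t / 2)) with (exp (t / 2) * exp (- t)).
      -- rewrite <- Rmult_assoc. apply Rmult_le_compat_r; [left; apply exp_pos|exact H].
      -- rewrite <- exp_plus. f_equal. field.
  + erewrite is_RInt_unique.
    2: { apply (is_RInt_scal (V := R_NormedModule)), is_RInt_exp_half. }
    unfold scal; simpl; unfold mult; simpl.
    apply Rmult_le_compat_l; [lra|].
    assert (exp (- a / 2) <= 1) by (rewrite <- exp_0; apply exp_le_mono; lra).
    assert (0 < exp (- B / 2)) by apply exp_pos. lra.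
- unfold Gamma. fold f.
  rewrite (is_RInt_gen_unique (V := R_CompleteNormedModule) f L HL1).
  eapply Rle_trans; [|apply (HL2 1 2); lra].
  replace (exp (- 2)) with (RInt (fun _ => exp (- 2)) 1 2)
    by (rewrite RInt_const; unfold scal; simpl; unfold mult; simpl; ring).
  apply RInt_le; [lra|apply ex_RInt_const|apply ex_RInt_pos; [exact Hc|lra..]|].
  intros t Ht. unfold f.
  assert (exp (- 2) <= exp (- t)) by (apply exp_le_mono; lra).
  assert (1 <= Rpower t (s - 1)).
  { apply Rle_trans with (exp 0); [rewrite exp_0; lra|].
    unfold Rpower. apply exp_le_mono.
    assert (0 <= ln t) by (rewrite <- ln_1; apply ln_le; lra). nra. }
  assert (0 < exp (- t)) by apply exp_pos. nra.
Qed.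

Definition BesselJ_coef (nu : R) (k : nat) : R := (-1) ^ k / (INR (fact k) * Gamma (INR k + nu + 1)).

Lemma Gamma_pos (s : R) : 1 < s -> 0 < Gamma s.
Proof. intros Hs. eapply Rlt_le_trans; [apply exp_pos|apply Gamma_lower_bound, Hs]. Qed.

Lemma BesselJ_coef_bound (nu : R) (k : nat) :
  0 < nu -> Rabs (BesselJ_coef nu k) <= exp 2 / INR (fact k).
Proof.
intros Hnu. unfold BesselJ_coef.
assert (Hk := pos_INR k). assert (Hf := INR_fact_lt_0 k).
assert (HG := Gamma_lower_bound (INR k + nu + 1) ltac:(lra)).
assert (HG0 := Gamma_pos (INR k + nu + 1) ltac:(lra)).
unfold Rdiv. rewrite Rabs_mult, pow_1_abs, Rmult_1_l, Rabs_inv, Rabs_pos_eq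
  by (apply Rmult_le_pos; lra).
rewrite Rinv_mult, Rmult_comm. apply Rmult_le_compat_r; [left; apply Rinv_0_lt_compat, Hf|].
replace (exp 2) with (/ exp (- 2)) by (rewrite <- exp_Ropp; f_equal; ring).
apply Rinv_le_contravar; [apply exp_pos|exact HG].
Qed.

(** The coefficients are at most [exp 2 / k!], and [r^k / k!] is bounded for every [r], so no finite
    radius is possible. *)
Lemma CV_radius_BesselJ_coef (nu : R) : 0 < nu -> CV_radius (BesselJ_coef nu) = p_infty.
Proof.
intros Hnu.
assert (Hb : forall r, Rbar_le (Finite r) (CV_radius (BesselJ_coef nu))).
{ intros r. apply CV_radius_bounded.
  destruct (maj_by_pos (fun n => r ^ n / INR (fact n))) as [M [HM0 HM]].
  { exists 0. apply cv_speed_pow_fact. }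
  exists (exp 2 * M). intros n.
  assert (Hf := INR_fact_lt_0 n).
  rewrite Rabs_mult. apply Rle_trans with (exp 2 / INR (fact n) * Rabs (r ^ n)).
  - apply Rmult_le_compat_r; [apply Rabs_pos|apply BesselJ_coef_bound, Hnu].
  - specialize (HM n). unfold Rdiv in HM. rewrite Rabs_mult in HM.
    rewrite (Rabs_pos_eq (/ INR (fact n))) in HM by (left; apply Rinv_0_lt_compat, Hf).
    unfold Rdiv. rewrite Rmult_assoc, (Rmult_comm (/ _)).
    apply Rmult_le_compat_l; [left; apply exp_pos|exact HM]. }
destruct (CV_radius (BesselJ_coef nu)) as [r| |].
- specialize (Hb (r + 1)). simpl in Hb. lra.
- reflexivity.
- destruct (Hb 0).
Qed.

Lemma continuous_BesselJ_series (nu x : R) : 0 < nu -> continuous (PSeries (BesselJ_coef nu)) x.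
Proof.
intros Hnu. apply continuity_pt_filterlim, PSeries_continuity.
rewrite CV_radius_BesselJ_coef by exact Hnu. exact I.
Qed.

Lemma BesselJ_RtoC (nu z : R) :
  BesselJ nu (RtoC z) =
  (Cpower (RtoC z / RtoC 2) nu * RtoC (PSeries (BesselJ_coef nu) ((z / 2) ^ 2)))%C.
Proof.
unfold BesselJ. f_equal.
assert (E : forall k, (RtoC ((-1) ^ k / (INR (fact k) * Gamma (INR k + nu + 1))) *
     (z / RtoC 2) ^ (2 * k))%C = RtoC (BesselJ_coef nu k * ((z / 2) ^ 2) ^ k)).
{ intros k. rewrite RtoC_mult. unfold BesselJ_coef. f_equal.
  rewrite <- RtoC_div by lra. rewrite <- RtoC_pow, pow_mult. reflexivity. }
unfold CSeries. apply injective_projections; simpl.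
- apply Series_ext. intros k. exact (f_equal Re (E k)).
(* The imaginary parts vanish termwise; writing zero as [0 * 0] lets [Series_scal_l] pull out the
   factor. *)
- rewrite (Series_ext _ (fun k => 0 * 0)).
  + rewrite Series_scal_l. ring.
  + intros k. rewrite Rmult_0_r. exact (f_equal Im (E k)).
Qed.

(** * Complex powers *)

Lemma Cpower_neq_0 (z : C) (a : R) : z <> RtoC 0 ->
  Cpower z a = (RtoC (Rpower (Cmod z) a) * (cos (a * Carg z), sin (a * Carg z)))%C.
Proof. intros Hz. unfold Cpower. destruct (Ceq_dec z 0); [contradiction|reflexivity]. Qed.

Lemma Cpower_plus (z : C) (a b : R) : z <> RtoC 0 ->
  Cpower z (a + b) = (Cpower z a * Cpower z b)%C.
Proof.
intros Hz. rewrite !Cpower_neq_0 by exact Hz.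
rewrite Rpower_plus, RtoC_mult, Rmult_plus_distr_r, cos_plus, sin_plus.
apply injective_projections; simpl; ring.
Qed.

Lemma Carg_scale (z : C) (t : R) : 0 < t -> Carg (z * RtoC t)%C = Carg z.
Proof.
intros Ht. unfold Carg.
rewrite Cmod_mult, Cmod_R, (Rabs_pos_eq t), re_scal_r by lra.
change (Im (z * RtoC t)%C) with (Re z * 0 + Im z * t).
replace (Re z * t / (Cmod z * t)) with (Re z / Cmod z).
- destruct (Rle_dec 0 (Im z)), (Rle_dec 0 (Re z * 0 + Im z * t)); try reflexivity; nra.
- unfold Rdiv. rewrite Rinv_mult.
  replace (Re z * t * (/ Cmod z * / t)) with (Re z * / Cmod z * (t * / t)) by ring.
  rewrite Rinv_r by lra. ring.
Qed.

(** Powers on the principal branch are not multiplicative in general, but a positive factor leaves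
    the argument unchanged. *)
Lemma Cpower_scale (z : C) (t a : R) : 0 < t ->
  Cpower (z * RtoC t)%C a = (Cpower z a * RtoC (Rpower t a))%C.
Proof.
intros Ht.
destruct (Ceq_dec z 0) as [->|Hz].
{ rewrite Cmult_0_l. unfold Cpower. destruct (Ceq_dec 0 0); [ring|contradiction]. }
assert (Hzt : (z * RtoC t)%C <> RtoC 0).
{ apply Cmult_neq_0; [exact Hz|]. intros E. apply RtoC_inj in E. lra. }
rewrite !Cpower_neq_0, Carg_scale by assumption.
rewrite Cmod_mult, Cmod_R, (Rabs_pos_eq t), <- Rpower_mult_distr, RtoC_mult
  by (try apply Cmod_gt_0; trivial; lra).
ring.
Qed.

Lemma Carg_1 : Carg (RtoC 1) = 0.
Proof.
unfold Carg. rewrite Cmod_R, Rabs_R1. simpl.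
destruct (Rle_dec 0 0) as [_|H]; [|lra]. unfold Rdiv. rewrite Rinv_1, Rmult_1_r. apply acos_1.
Qed.

Lemma Carg_m1 : Carg (RtoC (-1)) = PI.
Proof.
unfold Carg. rewrite Cmod_R, Rabs_m1. simpl.
destruct (Rle_dec 0 0) as [_|H]; [|lra]. unfold Rdiv. rewrite Rinv_1, Rmult_1_r.
change (-1) with (Ropp 1). rewrite acos_opp, acos_1. ring.
Qed.

Lemma Cpower_pos (t a : R) : 0 < t -> Cpower (RtoC t) a = RtoC (Rpower t a).
Proof.
intros Ht. rewrite <- (Cmult_1_l (RtoC t)), Cpower_scale by exact Ht.
rewrite Cpower_neq_0, Carg_1, Rmult_0_r, cos_0, sin_0 by (intros E; apply RtoC_inj in E; lra).
rewrite Cmod_R, Rabs_R1. unfold Rpower at 1. rewrite ln_1, Rmult_0_r, exp_0.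
change (1, 0) with (RtoC 1). ring.
Qed.

Lemma Cpower_1_RtoC (w : R) : w <> 0 -> Cpower (RtoC w) 1 = RtoC w.
Proof.
intros Hw. destruct (Rdichotomy _ _ Hw) as [H|H].
- replace (RtoC w) with (RtoC (-1) * RtoC (- w))%C by (rewrite <- RtoC_mult; f_equal; ring).
  rewrite Cpower_scale, Rpower_1 by lra.
  rewrite Cpower_neq_0, Carg_m1, Rmult_1_l, cos_PI, sin_PI by (intros E; apply RtoC_inj in E; lra).
  rewrite Cmod_R, Rabs_m1, Rpower_1 by lra.
  change (-1, 0) with (RtoC (-1)). ring.
- rewrite Cpower_pos, Rpower_1 by exact H. reflexivity.
Qed.

Lemma Cpower_INR_RtoC (w : R) (n : nat) : w <> 0 -> Cpower (RtoC w) (INR (S n)) = (RtoC w ^ S n)%C.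
Proof.
intros Hw. assert (RtoC w <> RtoC 0) by (intros E; apply RtoC_inj in E; contradiction).
induction n as [|n IH].
- simpl INR. rewrite Cpower_1_RtoC by exact Hw. simpl. ring.
- rewrite S_INR, Cpower_plus, IH, Cpower_1_RtoC by assumption. simpl. ring.
Qed.

Lemma Rpower_half (t : R) : 0 < t -> Rpower t (1 / 2) = sqrt t.
Proof. intros Ht. rewrite <- Rpower_sqrt by exact Ht. f_equal. field. Qed.

(** The Gamma and [2]-power constants cancel, and [w^(l+1) * w^(-l-1/2) = w^(1/2)] holds on the
    principal branch because both powers share one argument. *)
Lemma ytilde_normalized (l : nat) (w t : R) : w <> 0 -> 0 < t ->
  (RtoC w ^ (l + 1) / RtoC (Rpower 2 (INR l + 1 / 2) * Gamma (INR l + 3 / 2)) *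
   ytilde l (RtoC w) t)%C =
  (Csqrt (RtoC w * RtoC t) * BesselJ (INR l + 1 / 2) (RtoC w * RtoC t))%C.
Proof.
intros Hw Ht.
assert (HwC : RtoC w <> RtoC 0) by (intros E; apply RtoC_inj in E; contradiction).
unfold ytilde. destruct (Ceq_dec (RtoC w) 0) as [E|_]; [contradiction|].
unfold Csqrt. rewrite Cpower_scale, Rpower_half by exact Ht.
replace (Cpower (RtoC w) (1 / 2)) with (RtoC w ^ (l + 1) * Cpower (RtoC w) (- INR l - 1 / 2))%C.
- assert (HG := Gamma_pos (INR l + 3 / 2) ltac:(generalize (pos_INR l); lra)).
  assert (HP : 0 < Rpower 2 (INR l + 1 / 2)) by apply exp_pos.
  rewrite !RtoC_mult. field. split; intros E; apply RtoC_inj in E; lra.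
- rewrite Nat.add_1_r, <- Cpower_INR_RtoC, <- Cpower_plus by assumption.
  f_equal. rewrite S_INR. field.
Qed.

Lemma Rpower_succ_half (t : R) (l : nat) : 0 < t ->
  Rpower t (INR l + 3 / 2) = t ^ (l + 1) * sqrt t.
Proof.
intros Ht. rewrite <- Rpower_half, <- Rpower_pow, <- Rpower_plus by exact Ht.
f_equal. rewrite plus_INR. simpl. field.
Qed.

(** Rests on [sqrt w * t^(l+3/2) = t^(l+1) * sqrt (w t)]. It produces the prefactor
    [sqrt PI * t^(l+1)] of [K_N], so the terms of [u_N] become integrals against [K_N]. *)
Lemma I_lm_integrand (l : nat) (w t : R) : 0 < t ->
  (Csqrt (RtoC PI * RtoC w) *
   (Cpower (RtoC t) (INR l + 3 / 2) * BesselJ (INR l + 1 / 2) (RtoC w * RtoC t)))%C =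
  (RtoC (sqrt PI * t ^ (l + 1)) *
   (Csqrt (RtoC w * RtoC t) * BesselJ (INR l + 1 / 2) (RtoC w * RtoC t)))%C.
Proof.
intros Ht. unfold Csqrt.
rewrite (Cmult_comm (RtoC PI)), !Cpower_scale, !Rpower_half by (try apply PI_RGT_0; exact Ht).
rewrite (Cpower_pos t), Rpower_succ_half by exact Ht.
rewrite !RtoC_mult. ring.
Qed.

(** The half-integer powers of [t] combine into [t^(l+1)]. All branch choices sit in a factor
    independent of [t]; what remains is real and continuous on the whole line. *)
Lemma sqrt_BesselJ_entire (l : nat) (w t : R) : 0 < t ->
  (Csqrt (RtoC w * RtoC t) * BesselJ (INR l + 1 / 2) (RtoC w * RtoC t))%C =
  (Csqrt (RtoC w) * Cpower (RtoC w / RtoC 2) (INR l + 1 / 2) *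
   RtoC (t ^ (l + 1) * PSeries (BesselJ_coef (INR l + 1 / 2)) ((w * t / 2) ^ 2)))%C.
Proof.
intros Ht. rewrite <- (RtoC_mult w t), BesselJ_RtoC, RtoC_mult.
replace (RtoC w * RtoC t / RtoC 2)%C with (RtoC w / RtoC 2 * RtoC t)%C
  by (field; intros E; apply RtoC_inj in E; lra).
unfold Csqrt. rewrite !Cpower_scale by exact Ht.
replace (t ^ (l + 1)) with (Rpower t (1 / 2) * Rpower t (INR l + 1 / 2)).
- rewrite !RtoC_mult. ring.
- rewrite <- Rpower_plus, <- Rpower_pow by exact Ht. f_equal. rewrite plus_INR. simpl. field.
Qed.

(** * Continuity and integration of complex-valued functions *)

Notation Ccontinuous := (continuous (T := R_UniformSpace) (U := C_UniformSpace)).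

Lemma Ccontinuous_components (f : R -> C) (x : R) :
  continuous (fun t => Re (f t)) x -> continuous (fun t => Im (f t)) x -> Ccontinuous f x.
Proof.
intros H1 H2 P [eps HP].
assert (L1 := H1 _ (locally_ball (Re (f x)) eps)).
assert (L2 := H2 _ (locally_ball (Im (f x)) eps)).
unfold filtermap in L1, L2 |- *.
refine (filter_imp (F := locally (T := R_UniformSpace) x) _ _ _ (filter_and _ _ L1 L2)).
intros t [Ht1 Ht2].
apply HP. split; assumption.
Qed.

Lemma Ccontinuous_Re (f : R -> C) (x : R) : Ccontinuous f x -> continuous (fun t => Re (f t)) x.
Proof.
intros H. apply (continuous_comp (V := C_UniformSpace) f fst x H), continuous_fst.
Qed.

Lemma Ccontinuous_Im (f : R -> C) (x : R) : Ccontinuous f x -> continuous (fun t => Im (f t)) x.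
Proof.
intros H. apply (continuous_comp (V := C_UniformSpace) f snd x H), continuous_snd.
Qed.

Lemma Ccontinuous_RtoC (f : R -> R) (x : R) : continuous f x -> Ccontinuous (fun t => RtoC (f t)) x.
Proof. intros H. apply Ccontinuous_components; [exact H|apply continuous_const]. Qed.

Lemma Ccontinuous_plus (f g : R -> C) (x : R) :
  Ccontinuous f x -> Ccontinuous g x -> Ccontinuous (fun t => f t + g t)%C x.
Proof.
intros Hf Hg. apply Ccontinuous_components; apply (continuous_plus (V := R_NormedModule));
  (apply Ccontinuous_Re || apply Ccontinuous_Im); assumption.
Qed.

Lemma Ccontinuous_minus (f g : R -> C) (x : R) :
  Ccontinuous f x -> Ccontinuous g x -> Ccontinuous (fun t => f t - g t)%C x.
Proof.
intros Hf Hg. apply Ccontinuous_components; apply (continuous_minus (V := R_NormedModule));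
  (apply Ccontinuous_Re || apply Ccontinuous_Im); assumption.
Qed.

Lemma Ccontinuous_mult (f g : R -> C) (x : R) :
  Ccontinuous f x -> Ccontinuous g x -> Ccontinuous (fun t => f t * g t)%C x.
Proof.
intros Hf Hg.
assert (F1 := Ccontinuous_Re f x Hf). assert (F2 := Ccontinuous_Im f x Hf).
assert (G1 := Ccontinuous_Re g x Hg). assert (G2 := Ccontinuous_Im g x Hg).
apply Ccontinuous_components.
- apply (continuous_minus (V := R_NormedModule)); apply (continuous_mult (K := R_AbsRing)); assumption.
- apply (continuous_plus (V := R_NormedModule)); apply (continuous_mult (K := R_AbsRing)); assumption.
Qed.

Lemma Ccontinuous_sum_n (f : nat -> R -> C) (n : nat) (x : R) :
  (forall k, Ccontinuous (f k) x) -> Ccontinuous (fun t => sum_n (fun k => f k t) n) x.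
Proof.
intros H. induction n as [|n IH].
- apply (continuous_ext (f 0%nat)); [intros t; rewrite sum_O; reflexivity|apply H].
- apply (continuous_ext (fun t => (sum_n (fun k => f k t) n + f (S n) t)%C)).
  + intros t. rewrite sum_Sn. reflexivity.
  + apply Ccontinuous_plus; [exact IH|apply H].
Qed.

Lemma continuous_Cmod (f : R -> C) (x : R) : Ccontinuous f x -> continuous (fun t => Cmod (f t)) x.
Proof.
intros H.
apply (continuous_ext (fun t => norm (V := C_R_NormedModule) (f t))).
- intros t. apply norm_C_R.
- apply (continuous_comp (V := C_UniformSpace) f (norm (V := C_R_NormedModule)) x H).
  apply (filterlim_norm (V := C_R_NormedModule)).
Qed.

Lemma continuous_sum_n_R (f : nat -> R -> R) (n : nat) (x : R) :
  (forall k, continuous (f k) x) -> continuous (fun t => sum_n (fun k => f k t) n) x.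
Proof.
intros H. induction n as [|n IH].
- apply (continuous_ext (f 0%nat)); [intros t; rewrite sum_O; reflexivity|apply H].
- apply (continuous_ext (fun t => (sum_n (fun k => f k t) n + f (S n) t))).
  + intros t. rewrite sum_Sn. reflexivity.
  + apply (continuous_plus (V := R_NormedModule)); [exact IH|apply H].
Qed.

Lemma continuous_JacobiP (m : nat) (a b x t : R) :
  continuous (fun t => JacobiP m a b (1 - 2 * t ^ 2 / x ^ 2)) t.
Proof.
unfold JacobiP. apply continuous_sum_n_R. intros k.
apply (ex_derive_continuous (V := R_NormedModule)). auto_derive. repeat split.
Qed.

Lemma Ccontinuous_K_N (l : nat) (Rk : R -> R -> C) (N : nat) (x t : R) :
  Ccontinuous (K_N l Rk N x) t.
Proof.
unfold K_N. apply Ccontinuous_mult.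
- apply Ccontinuous_RtoC, (ex_derive_continuous (V := R_NormedModule)). auto_derive. repeat split.
- apply (Ccontinuous_sum_n (fun m t => coefN l Rk m x *
     RtoC (JacobiP m (INR l + 1 / 2) (INR l + 1) (1 - 2 * t ^ 2 / x ^ 2)))%C).
  intros m. apply Ccontinuous_mult; [apply continuous_const|].
  apply Ccontinuous_RtoC, continuous_JacobiP.
Qed.

(* [is_RInt_ext] and [sum_n_ext] leave equations at a structure type that
   [ring] and [field] do not recognize as [C]. *)
Ltac as_Ceq := match goal with |- ?a = ?b => change (@eq C a b) end.

(** [C] is integrated as a real space, where scalars are real; a complex constant is therefore moved
    out componentwise. *)
Lemma is_RInt_Cmult_l (c : C) (f : R -> C) (a b : R) (If : C) :
  is_RInt (V := C_R_NormedModule) f a b If ->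
  is_RInt (V := C_R_NormedModule) (fun t => c * f t)%C a b (c * If)%C.
Proof.
intros H.
assert (H1 := is_RInt_fct_extend_fst (U := R_NormedModule) (V := R_NormedModule) f a b If H).
assert (H2 := is_RInt_fct_extend_snd (U := R_NormedModule) (V := R_NormedModule) f a b If H).
apply (is_RInt_fct_extend_pair (U := R_NormedModule) (V := R_NormedModule) (fun t => (c * f t)%C)).
- apply (is_RInt_minus (V := R_NormedModule)); apply (is_RInt_scal (V := R_NormedModule)); assumption.
- apply (is_RInt_plus (V := R_NormedModule)); apply (is_RInt_scal (V := R_NormedModule)); assumption.
Qed.

Lemma is_RInt_Csum_n (f : nat -> R -> C) (I : nat -> C) (a b : R) (n : nat) :
  (forall k, is_RInt (V := C_R_NormedModule) (f k) a b (I k)) ->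
  is_RInt (V := C_R_NormedModule) (fun t => sum_n (fun k => f k t) n) a b (sum_n I n).
Proof.
intros H. induction n as [|n IH].
- rewrite sum_O. apply (is_RInt_ext (V := C_R_NormedModule) (f 0%nat)).
  + intros t _. rewrite sum_O. reflexivity.
  + apply H.
- rewrite sum_Sn.
  apply (is_RInt_ext (V := C_R_NormedModule) (fun t => plus (sum_n (fun k => f k t) n : C_R_NormedModule) (f (S n) t))).
  + intros t _. rewrite sum_Sn. reflexivity.
  + apply (is_RInt_plus (V := C_R_NormedModule)); [exact IH|apply H].
Qed.

Lemma sum_n_Cmult_r (a : nat -> C) (c : C) (n : nat) :
  (sum_n a n * c)%C = sum_n (fun k => a k * c)%C n.
Proof.
induction n as [|n IH].
- rewrite !sum_O. reflexivity.
- rewrite !sum_Sn, <- IH. unfold plus; simpl. ring.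
Qed.

Lemma continuous_on_kernel_slice (b x : R) (K : R -> R -> C) :
  continuous_on (T := prod_UniformSpace R_UniformSpace R_UniformSpace)
    (U := C_UniformSpace)
    (fun p => 0 <= snd p <= fst p /\ fst p <= b) (fun p => K (fst p) (snd p)) ->
  x <= b ->
  continuous_on (T := R_UniformSpace) (U := C_UniformSpace) (fun t => 0 <= t <= x) (K x).
Proof.
intros H Hx t Ht P HP.
destruct (H (x, t) (conj Ht Hx) P HP) as [e He].
exists e. intros s Hs Hs2. apply (He (x, s)).
- split; [apply ball_center|exact Hs].
- split; [exact Hs2|exact Hx].
Qed.

Lemma Cpower_nonzero (z : C) (a : R) : z <> RtoC 0 -> Cpower z a <> RtoC 0.
Proof.
intros Hz E.
assert (H := Cpower_plus z a (- a) Hz).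
rewrite E, Cmult_0_l, Rplus_opp_r, Cpower_neq_0 in H by exact Hz.
rewrite Rmult_0_l, cos_0, sin_0, Rpower_O in H by (apply Cmod_gt_0, Hz).
change (1, 0) with (RtoC 1) in H. rewrite Cmult_1_l in H. apply RtoC_inj in H. lra.
Qed.

(** * The error representation *)

Lemma Ck_on_segment_bounded (n : nat) (b : R) (q : R -> C) :
  0 < b -> Ck_on n (fun x => 0 <= x <= b) q ->
  exists M, forall x, half_open b x -> Cmod (q x) <= M.
Proof.
intros Hb [d [Hd [_ Hc]]].
destruct (continuous_on_segment_bounded 0 b (d 0%nat) ltac:(lra) (Hc 0%nat ltac:(lia))) as [M HM].
exists M. intros x [Hx1 Hx2]. rewrite <- Hd by lra. apply HM; lra.
Qed.

Lemma regular_solution_eq_scaled_utilde (b : R) (l : nat) (q : R -> C) (u : C -> R -> C)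
  (K : R -> R -> C) (w : C) (x : R) :
  0 < b -> (exists M, forall x, half_open b x -> Cmod (q x) <= M) ->
  regular_solution l q b u -> is_kernel_K l q b K -> w <> RtoC 0 -> half_open b x ->
  u w x = (w ^ (l + 1) / RtoC (Rpower 2 (INR l + 1 / 2) * Gamma (INR l + 3 / 2)) *
           utilde l K w x)%C.
Proof.
intros Hb Hq [Hu _] [_ [_ HK]] Hw Hx.
destruct (Hu w Hw) as [Su Eu]. destruct (HK w) as [Sv Ev].
assert (HG := Gamma_pos (INR l + 3 / 2) ltac:(generalize (pos_INR l); lra)).
assert (HP : 0 < Rpower 2 (INR l + 1 / 2)) by apply exp_pos.
assert (HD : RtoC (Rpower 2 (INR l + 1 / 2) * Gamma (INR l + 3 / 2)) <> RtoC 0).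
{ intros E. apply RtoC_inj in E. nra. }
apply (solves_Bessel_proportional l q b w _ (u w) (utilde l K w) Hb Hq Su Sv); [|exact Ev| |exact Hx].
- unfold Cdiv. apply Cmult_neq_0; [apply Cpow_nz, Hw|].
  intros E. assert (E2 := Cinv_r _ HD). rewrite E, Cmult_0_r in E2. apply RtoC_inj in E2. lra.
- refine (filterlim_ext _ _ _ Eu). intros t. cbv beta. f_equal.
  rewrite Cpow_mult_l, RtoC_pow. field. exact HD.
Qed.

(** [A * g t] is the factored form of [sqrt (w t) J (w t)] and [Kc] a continuous extension of [K x].
    Both [u] and [u_N] are this function at [x] plus its integral against a kernel, so the leading
    terms cancel. *)
Lemma u_minus_u_N_is_RInt (b : R) (l : nat) (q : R -> C) (u : C -> R -> C)
  (K Rk : R -> R -> C) (x w : R) (N : nat) (Kc : R -> C) (g : R -> R) (A : C) :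
  0 < b -> (exists M, forall x, half_open b x -> Cmod (q x) <= M) ->
  regular_solution l q b u -> is_kernel_K l q b K -> w <> 0 -> half_open b x ->
  (forall t, Ccontinuous Kc t) -> (forall t, 0 <= t <= x -> Kc t = K x t) ->
  (forall t, continuous g t) ->
  (forall t, 0 < t -> (Csqrt (RtoC w * RtoC t) *
     BesselJ (INR l + 1 / 2) (RtoC w * RtoC t))%C = (A * RtoC (g t))%C) ->
  is_RInt (V := C_R_NormedModule)
    (fun t => (Kc t - K_N l Rk N x t) * (A * RtoC (g t)))%C 0 x
    (u (RtoC w) x - u_N l Rk N (RtoC w) x)%C.
Proof.
intros Hb Hq Hu HK Hw Hx HKc HKe Hg HA.
assert (HwC : RtoC w <> RtoC 0) by (intros E; apply RtoC_inj in E; contradiction).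
assert (Hl := pos_INR l).
assert (HG := Gamma_pos (INR l + 3 / 2) ltac:(lra)).
assert (HP : 0 < Rpower 2 (INR l + 1 / 2)) by apply exp_pos.
assert (HS : forall t, Ccontinuous (fun t => A * RtoC (g t))%C t).
{ intros t. apply Ccontinuous_mult; [apply continuous_const|apply Ccontinuous_RtoC, Hg]. }
assert (Hint : forall f : R -> C, (forall t, Ccontinuous f t) ->
  is_RInt (V := C_R_NormedModule) f 0 x (CInt f 0 x)).
{ intros f Hf. apply (RInt_correct (V := C_R_CompleteNormedModule)).
  apply (ex_RInt_continuous (V := C_R_CompleteNormedModule)). intros t _. apply Hf. }
assert (Hx0 : 0 < x) by apply Hx.
set (c := (RtoC w ^ (l + 1) / RtoC (Rpower 2 (INR l + 1 / 2) * Gamma (INR l + 3 / 2)))%C).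
assert (Hc : c <> RtoC 0).
{ unfold c, Cdiv. apply Cmult_neq_0; [apply Cpow_nz, HwC|].
  rewrite <- RtoC_inv by nra. intros E. apply RtoC_inj in E.
  revert E. apply Rinv_neq_0_compat. nra. }
assert (I1 : is_RInt (V := C_R_NormedModule) (fun t => Kc t * (A * RtoC (g t)))%C 0 x
  (u (RtoC w) x - A * RtoC (g x))%C).
{ rewrite (regular_solution_eq_scaled_utilde b l q u K w x Hb Hq Hu HK HwC Hx).
  fold c. unfold utilde. rewrite Cmult_plus_distr_l. unfold c at 1.
  rewrite ytilde_normalized, HA by assumption.
  set (J := CInt (fun t => Kc t * (A * RtoC (g t)))%C 0 x).
  assert (HI := Hint _ (fun t => Ccontinuous_mult _ _ t (HKc t) (HS t))). fold J in HI.
  replace (CInt (fun t => K x t * ytilde l w t)%C 0 x) with (/ c * J)%C.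
  - assert (EI : (A * g x + c * (/ c * J) - A * g x)%C = J) by (field; exact Hc).
    rewrite EI. exact HI.
  - symmetry. apply (is_RInt_unique (V := C_R_CompleteNormedModule)).
    (* The integrands are compared only on the open interval, so [t > 0] as the factorization
       requires. The relation is used divided by [c], which is nonzero. *)
    apply (is_RInt_ext (V := C_R_NormedModule) (fun t => / c * (Kc t * (A * RtoC (g t))))%C).
    + intros t Ht. rewrite Rmin_left, Rmax_right in Ht by lra.
      rewrite <- HA, HKe by lra. rewrite <- ytilde_normalized by lra. fold c. as_Ceq. field. exact Hc.
    + apply is_RInt_Cmult_l, HI. }
set (c0 := Csqrt (RtoC PI * RtoC w)).
assert (Hc0 : c0 <> RtoC 0).
{ apply Cpower_nonzero, Cmult_neq_0; [|exact HwC]. intros E. apply RtoC_inj in E.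
  generalize PI_RGT_0. lra. }
set (Jac := fun m t => JacobiP m (INR l + 1 / 2) (INR l + 1) (1 - 2 * t ^ 2 / x ^ 2)).
assert (I2 : forall m, is_RInt (V := C_R_NormedModule)
  (fun t => RtoC (sqrt PI * t ^ (l + 1) * Jac m t) * (A * RtoC (g t)))%C 0 x
  (c0 * I_lm l m w x)%C).
{ intros m.
  assert (HI : is_RInt (V := C_R_NormedModule)
    (fun t => RtoC (sqrt PI * t ^ (l + 1) * Jac m t) * (A * RtoC (g t)))%C 0 x
    (CInt (fun t => RtoC (sqrt PI * t ^ (l + 1) * Jac m t) * (A * RtoC (g t)))%C 0 x)).
  { apply Hint. intros t. apply Ccontinuous_mult; [|apply HS].
    apply Ccontinuous_RtoC, (continuous_mult (K := R_AbsRing)); [|apply continuous_JacobiP].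
    apply (ex_derive_continuous (V := R_NormedModule)). auto_derive. repeat split. }
  match type of HI with is_RInt _ _ _ ?J0 => set (J := J0) in HI end.
  replace (c0 * I_lm l m w x)%C with J; [exact HI|].
  replace (I_lm l m w x) with (/ c0 * J)%C; [field; exact Hc0|].
    symmetry. apply (is_RInt_unique (V := C_R_CompleteNormedModule)).
    apply (is_RInt_ext (V := C_R_NormedModule)
      (fun t => / c0 * (RtoC (sqrt PI * t ^ (l + 1) * Jac m t) * (A * RtoC (g t))))%C).
    + intros t Ht. rewrite Rmin_left, Rmax_right in Ht by lra.
      rewrite (RtoC_mult _ (Jac m t)), <- HA by lra.
      replace (RtoC (sqrt PI * t ^ (l + 1)) * RtoC (Jac m t) *
        (Csqrt (RtoC w * RtoC t) * BesselJ (INR l + 1 / 2) (RtoC w * RtoC t)))%C with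
        (RtoC (sqrt PI * t ^ (l + 1)) *
        (Csqrt (RtoC w * RtoC t) * BesselJ (INR l + 1 / 2) (RtoC w * RtoC t)) * RtoC (Jac m t))%C by ring.
      rewrite <- I_lm_integrand by lra. fold c0. unfold Jac. as_Ceq. field. exact Hc0.
    + apply is_RInt_Cmult_l, HI. }
set (D := x ^ (2 * l + 3) * Gamma (INR l + 3 / 2)).
assert (HD : 0 < D) by (apply Rmult_lt_0_compat; [apply pow_lt|]; assumption).
assert (HDC : RtoC D <> RtoC 0) by (intros E; apply RtoC_inj in E; lra).
(* [D] is the common denominator of [K_N] and [u_N]; by linearity the termwise integrals [I2]
   assemble into the one against [K_N]. *)
assert (I3 : is_RInt (V := C_R_NormedModule) (fun t => K_N l Rk N x t * (A * RtoC (g t)))%C 0 x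
  (u_N l Rk N (RtoC w) x - A * RtoC (g x))%C).
{ unfold u_N. rewrite HA by exact Hx0. fold c0 D.
  set (T := sum_n (fun m => coefN l Rk m x * I_lm l m w x)%C N).
  assert (ET : (A * RtoC (g x) + c0 / RtoC D * T - A * RtoC (g x))%C =
    (/ RtoC D * sum_n (fun m => coefN l Rk m x * (c0 * I_lm l m w x))%C N)%C).
  { rewrite (sum_n_ext _ (fun m => coefN l Rk m x * I_lm l m w x * c0)%C)
      by (intros m; as_Ceq; ring).
    rewrite <- sum_n_Cmult_r. fold T. field. exact HDC. }
  rewrite ET.
  apply (is_RInt_ext (V := C_R_NormedModule) (fun t => / RtoC D * sum_n (fun m =>
    coefN l Rk m x * (RtoC (sqrt PI * t ^ (l + 1) * Jac m t) * (A * RtoC (g t)))) N)%C).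
  - intros t _. unfold K_N. fold D.
    rewrite (sum_n_ext _ (fun m => coefN l Rk m x * RtoC (Jac m t) *
      (RtoC (sqrt PI * t ^ (l + 1)) * (A * RtoC (g t))))%C).
    + rewrite <- sum_n_Cmult_r.
      unfold Rdiv at 1. rewrite (RtoC_mult _ (/ D)), RtoC_inv by lra.
      unfold Jac.
      as_Ceq. ring.
    + intros m. rewrite (RtoC_mult _ (Jac m t)).
      as_Ceq. ring.
  - apply is_RInt_Cmult_l.
    apply (is_RInt_Csum_n (fun m t => coefN l Rk m x *
      (RtoC (sqrt PI * t ^ (l + 1) * Jac m t) * (A * RtoC (g t))))%C
      (fun m => coefN l Rk m x * (c0 * I_lm l m w x))%C).
    intros m. apply is_RInt_Cmult_l, I2. }
assert (EI : (u (RtoC w) x - u_N l Rk N (RtoC w) x)%C =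
  minus (u (RtoC w) x - A * RtoC (g x) : C_R_NormedModule)%C
    (u_N l Rk N (RtoC w) x - A * RtoC (g x) : C_R_NormedModule)%C).
{ unfold minus, plus, opp; apply injective_projections; simpl; unfold plus, opp; simpl; ring. }
rewrite EI.
apply (is_RInt_ext (V := C_R_NormedModule) (fun t => minus (Kc t * (A * RtoC (g t)) : C_R_NormedModule)%C
  (K_N l Rk N x t * (A * RtoC (g t)) : C_R_NormedModule)%C)).
- intros t _.
  unfold minus, plus, opp; apply injective_projections; simpl; unfold plus, opp; simpl; ring.
- apply (is_RInt_minus (V := C_R_NormedModule)); assumption.
Qed.

Lemma u_N_0 (l : nat) (Rk : R -> R -> C) (N : nat) (x : R) : u_N l Rk N (RtoC 0) x = RtoC 0.
Proof.
assert (E : Csqrt (RtoC 0) = RtoC 0).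
{ unfold Csqrt, Cpower. destruct (Ceq_dec 0 0); [reflexivity|contradiction]. }
unfold u_N. rewrite Cmult_0_l, Cmult_0_r, E. unfold Cdiv. ring.
Qed.

Theorem theorem4 :
  forall (b : R) (l : nat) (q : R -> C)
         (u : C -> R -> C) (K Rk : R -> R -> C) (cl : R),
    0 < b ->
    (1 <= l)%nat ->
    Ck_on (2 * l + 1) (fun x => 0 <= x <= b) q ->
    regular_solution l q b u ->
    is_kernel_K l q b K ->
    is_kernel_R l b K Rk ->
    (forall z : R,
       Cmod (Csqrt (RtoC z) * BesselJ (INR l + 1 / 2) (RtoC z))%C <= cl) ->
    forall (x : R) (N : nat) (w : R),
      0 < x <= b ->
      Cmod (u (RtoC w) x - u_N l Rk N (RtoC w) x)%C <= cl * epsN l K Rk N x.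
Proof.
intros b l q u K Rk cl Hb _ Hq Hu HK _ Hcl x N w Hx.
assert (Hcl0 : 0 <= cl) by (eapply Rle_trans; [apply Cmod_ge_0|apply (Hcl 0)]).
pose (Kc := fun t => K x (Rmax 0 (Rmin x t))).
assert (HKc : forall t, Ccontinuous Kc t).
{ apply (continuous_clamp C_UniformSpace); [lra|].
  apply (continuous_on_kernel_slice b); [apply HK|lra]. }
assert (HKe : forall t, 0 <= t <= x -> Kc t = K x t).
{ intros t Ht. unfold Kc. rewrite clamp_id by exact Ht. reflexivity. }
assert (HE : is_RInt (fun t => Cmod (Kc t - K_N l Rk N x t)%C) 0 x (epsN l K Rk N x)).
{ replace (epsN l K Rk N x) with (RInt (fun t => Cmod (Kc t - K_N l Rk N x t)%C) 0 x).
  - apply (RInt_correct (V := R_CompleteNormedModule)).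
    apply (ex_RInt_continuous (V := R_CompleteNormedModule)). intros t _.
    apply continuous_Cmod, Ccontinuous_minus; [apply HKc|apply Ccontinuous_K_N].
  - apply RInt_ext. intros t Ht. rewrite Rmin_left, Rmax_right in Ht by lra.
    rewrite HKe by lra. reflexivity. }
(* The rescaling divides by a power of [w], so [w = 0] is separate; there the estimate reduces to
   [cl] and [epsN] being nonnegative. *)
destruct (Req_dec w 0) as [->|Hw].
{ rewrite u_N_0. destruct Hu as [_ Hu]. rewrite Hu by exact Hx.
  replace (0 - 0)%C with (RtoC 0) by ring. rewrite Cmod_0.
  apply Rmult_le_pos; [exact Hcl0|].
  apply (is_RInt_ge_0 _ 0 x _ ltac:(lra) HE). intros; apply Cmod_ge_0. }
pose (g := fun t => t ^ (l + 1) * PSeries (BesselJ_coef (INR l + 1 / 2)) ((w * t / 2) ^ 2)).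
assert (Hg : forall t, continuous g t).
{ intros t. apply (continuous_mult (K := R_AbsRing)).
  - apply (ex_derive_continuous (V := R_NormedModule)). auto_derive. repeat split.
  - apply (continuous_comp (fun t => (w * t / 2) ^ 2)).
    + apply (ex_derive_continuous (V := R_NormedModule)). auto_derive. repeat split.
    + apply continuous_BesselJ_series. generalize (pos_INR l). lra. }
assert (HI := u_minus_u_N_is_RInt b l q u K Rk x w N Kc g _ Hb (Ck_on_segment_bounded _ b q Hb Hq)
  Hu HK Hw Hx HKc HKe Hg (sqrt_BesselJ_entire l w)).
rewrite <- norm_C_R.
refine (norm_RInt_le (V := C_R_NormedModule) _ _ 0 x _ _ ltac:(lra) _ HI
  (is_RInt_scal (V := R_NormedModule) _ 0 x cl _ HE)).
intros t Ht. cbv beta. rewrite norm_C_R, Cmod_mult.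
change (scal cl ?y) with (cl * y). rewrite Rmult_comm.
apply Rmult_le_compat_r; [apply Cmod_ge_0|].
(* The pointwise bound is required on the closed interval. The factorization covers [t > 0]; at
   [t = 0] the factor [t^(l+1)] makes [g] vanish. *)
destruct (Rle_lt_or_eq_dec 0 t (proj1 Ht)) as [Ht0| <-].
- unfold g. rewrite <- sqrt_BesselJ_entire, <- RtoC_mult by exact Ht0. apply Hcl.
- unfold g. rewrite pow_i, Rmult_0_l, Cmult_0_r, Cmod_0 by lia. exact Hcl0.
Qed.
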